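(* Suppose each nonnegative integer $x$ is coded by a binary string consisting of $0$'s and $1$'s, and let $\tilde S(x)$ denote the number of $1$'s in the coding string of $x$. For each nonnegative integer $n$ let $\tilde S_n=\tilde S(X)$, where $X$ is a random integer uniformly distributed over $\{0,1,\ldots,n\}$. Assume that for all $m\ge1$, $$\tilde S_{2m-1}=\tilde S_{m-1}+\mathcal I\quad\text{in distribution},$$ where $\mathcal I$ is a Bernoulli$(1/2)$ random variable independent of $\tilde S_{m-1}$. For $n\ge1$, let $k$ be the integer such that $2^{k-1}-1<n\le2^k-1$, and let $\tilde W_n=(\tilde S_n-k/2)/\sqrt{k/4}$. Then $$\frac{P(\tilde W_n\ge x)}{1-\Phi(x)}=1+O(1)(1+x^3)\frac1{\sqrt k}$$ for $0\le x\le k^{1/6}$.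
   Context: $\Phi$ is the standard normal distribution function. $O(1)$ denotes a quantity whose absolute value is bounded by a constant not depending on $n$ and $x$ (for the given system of codes). *)

(* Defs.v *)
From HB Require Import structures.
From mathcomp Require Import all_boot all_order all_algebra.
From mathcomp Require Import all_classical all_reals all_analysis.

Set Implicit Arguments.
Unset Strict Implicit.
Unset Printing Implicit Defensive.

Import Order.TTheory GRing.Theory Num.Theory.
Import numFieldNormedType.Exports.

Local Open Scope classical_set_scope.
Local Open Scope ring_scope.

(* The uniform law on {0, ..., n}, as a probability measure on nat (whose
   sigma-algebra is discrete). *)
Definition uniform_upto {R : realType} (n : nat) : set nat -> \bar R :=
  mscale (n.+1%:R^-1)%:nng (msum (fun i : nat => \d_i) n.+1).

Section uniform_upto.
Context {R : realType} (n : nat).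

HB.instance Definition _ := Measure.on (@uniform_upto R n).

Let uniform_upto_setT : @uniform_upto R n [set: nat] = 1%E.
Proof.
rewrite /uniform_upto /mscale/= /msum.
rewrite (eq_bigr (fun=> 1%E)) => [|i _]; last by rewrite /= diracE mem_set.
by rewrite sumEFin sumr_const card_ord -EFinM mulVf// pnatr_eq0.
Qed.

HB.instance Definition _ :=
  @Measure_isProbability.Build _ _ R (@uniform_upto R n) uniform_upto_setT.

End uniform_upto.

Definition ones (code : nat -> seq bool) (x : nat) : nat :=
  count_mem true (code x).

Section ones.
Variable code : nat -> seq bool.

Let measurable_ones : measurable_fun [set: nat] (ones code).
Proof. by []. Qed.

HB.instance Definition _ :=
  isMeasurableFun.Build _ _ _ _ (ones code) measurable_ones.

End ones.

(* The random integer X is the identity on the probability space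
   (nat, uniform_upto n), so the random variable counting the 1's in the code
   of X is ones code itself. *)
Definition ones_law (R : realType) (code : nat -> seq bool) (n : nat) :
    set nat -> \bar R :=
  distribution (@uniform_upto R n) (ones code).

HB.instance Definition _ (R : realType) (code : nat -> seq bool) (n : nat) :=
  Probability.on (ones_law R code n).

(* The law of Y + I, for Y distributed according to mu and I a Bernoulli(1/2)
   variable independent of Y: the joint law of (Y, I) is the product measure. *)
Definition add_bernoulli_half {R : realType} (mu : probability nat R) :
    set nat -> \bar R :=
  pushforward (mu \x bernoulli_prob (2^-1 : R))%E
    (fun yi : nat * bool => (yi.1 + yi.2)%N).

Definition standardized_ones {R : realType} (code : nat -> seq bool) (k : nat)
    (y : nat) : R :=
  ((ones code y)%:R - k%:R / 2) / Num.sqrt (k%:R / 4).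

Definition Phi {R : realType} (x : R) : R := fine (normal_prob 0 1 `]-oo, x]).

(* Main.v *)
From HB Require Import structures.
Require Import Defs.
From mathcomp Require Import all_boot all_order all_algebra ring lra zify.
From mathcomp Require Import all_classical all_reals all_analysis.

Set Implicit Arguments.
Unset Strict Implicit.
Unset Printing Implicit Defensive.

Import Order.TTheory GRing.Theory Num.Theory.
Import numFieldNormedType.Exports.

Local Open Scope classical_set_scope.
Local Open Scope ring_scope.

(** The law of the number of ones on [0, 2^k) is forced by the recursion to be
    that of c0 + Bin(k, 1/2), where c0 is the number of ones in the code of 0;
    for a general N in (2^(k-1), 2^k] the interval [0, N) splits, along the
    binary digits of N, into blocks of sizes w_i <= 2^(k-i).  On the block
    number i the law is that of Bin(k-i, 1/2) shifted by an integer between c0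
    and c0 + i, so its upper tail at r lies between the tails of Bin(k, 1/2) at
    r - c0 + i and at r - c0 - i ([count_ge_mixture]).  As w_i / N decays like
    2^(-i), the tail of S_n is a geometric mixture of binomial tails at
    thresholds displaced by O(i).

    It remains to know the tail of one binomial law up to a relative error
    (1 + x^3) / sqrt k, and how it reacts to a displacement of the threshold.

    For the first point an even number 2h of trials is enough, since by Pascal's
    rule one more trial displaces the threshold by at most one.  The ratio of
    consecutive binomial coefficients C(2h, h+l+1) / C(2h, h+l) is
    (1-u)/(1+u) with u = (2l+1)/(2h+1), and this is e^(-2u) up to a factor
    1 - u^3.  Multiplying up,
        e^(-t^2/2) (1 - t^4/(8(2h+1))) <= C(2h,j)/C(2h,h) <= e^(-t^2/2)
    at the standardized point t = (j-h) d of mesh d = 2/sqrt(2h+1)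
    ([central_ratio_le], [central_ratio_ge]).  Summing over j and comparing with
    Gaussian integrals over cells of length d gives both tails up to a common
    normalizing factor kappa ([kappa_bintail_le], [kappa_bintail_ge]).  No form
    of Stirling's formula is involved: kappa = 1 + O(d) because the total mass
    of the binomial law is one ([kappa_le], [kappa_ge]).

    For the second point, the hazard rate of the normal law is at most 1 + x
    ([mills]), so that a displacement d of the threshold changes the normal tail
    at x by a factor of at most e^((1+x)d) ([ntail_shift]).  With d of order
    i/sqrt k this growth in i is beaten by the weights 2^(-i) as soon as
    (1+x)/sqrt k is small, which holds for x <= k^(1/6) and k large
    ([count_ge_moderate]).  For the finitely many remaining k the quotient is
    merely bounded. *)

(** * Monotonicity from the sign of a derivative *)

Section Calculus.
Context {R : realType}.
Implicit Types (f df : R -> R) (a b x : R).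

Lemma le0_derive_nincr f df a b : a <= b ->
  (forall x, a <= x <= b -> is_derive x 1 f (df x)) ->
  (forall x, a <= x <= b -> df x <= 0) -> f b <= f a.
Proof.
move=> ab fdf df0.
have [<-//|neq] := eqVneq a b.
have ltab : a < b by rewrite lt_neqAle neq.
have inab x : x \in `]a, b[ -> a <= x <= b.
  by rewrite in_itv/= => /andP[/ltW-> /ltW->].
have [|x] := @MVT R f df a b ltab (fun x xab => fdf x (inab x xab)).
  apply: derivable_within_continuous => x; rewrite in_itv/= => xab.
  by have [] := fdf x xab.
move=> xab; rewrite -subr_le0 => ->.
by rewrite mulr_le0_ge0 ?subr_ge0// df0// inab.
Qed.

Lemma ge0_derive_ndecr f df a b : a <= b ->
  (forall x, a <= x <= b -> is_derive x 1 f (df x)) ->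
  (forall x, a <= x <= b -> 0 <= df x) -> f a <= f b.
Proof.
move=> ab fdf df0; rewrite -lerN2.
apply: (@le0_derive_nincr (\- f) (fun x => - df x)) => // x xab.
  by have := fdf x xab => ?; apply: is_deriveN.
by rewrite oppr_le0 df0.
Qed.

Lemma mvt_cell f df a b : a <= b -> (forall x, is_derive x 1 f (df x)) ->
  exists2 c, a <= c <= b & f b - f a = df c * (b - a).
Proof.
move=> ab fdf; have [|c cab ->] := @MVT_segment R f df a b ab (fun x _ => fdf x).
  by apply: derivable_within_continuous => x _; have [] := fdf x.
by exists c => //; move: cab; rewrite in_itv.
Qed.

End Calculus.

(** * The tail of the standard normal law *)

Section NormalTail.
Context {R : realType}.
Implicit Types x d u : R.

Definition npdf (x : R) : R := normal_pdf 0 1 x.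
Definition ntail (x : R) : R := 1 - Phi x.

Lemma npdfE x : npdf x = normal_peak 1 * expR (- (x ^+ 2) / 2).
Proof.
by rewrite /npdf normal_pdfE ?oner_neq0// /normal_fun subr0 expr1n.
Qed.

Lemma npdf_gt0 x : 0 < npdf x.
Proof. by rewrite npdfE mulr_gt0 ?expR_gt0// normal_peak_gt0 ?oner_neq0. Qed.

Lemma npdf_anti x y : x ^+ 2 <= y ^+ 2 -> npdf y <= npdf x.
Proof.
move=> xy; rewrite !npdfE ler_wpM2l ?normal_peak_ge0// ler_expR.
by rewrite ler_wpM2r// lerN2.
Qed.

Lemma is_derive_npdf x : is_derive x 1 npdf (- (x * npdf x)).
Proof.
have -> : npdf = fun y => normal_peak 1 * expR (- (y ^+ 2) / 2).
  by apply/funext => y; rewrite npdfE.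
apply: is_derive_eq.
rewrite /GRing.scale/=; lra.
Qed.

Lemma is_derive_ntail x : is_derive x 1 ntail (- npdf x).
Proof.
have F : is_derive x 1 (@Phi R) (npdf x).
  have [||//||D] := @continuous_FTC1 R npdf -oo%O x (x + 1).
  - by rewrite ltrDl.
  - by apply: (integrableS _ _ (subsetT _)) => //; exact: integrable_normal_pdf.
  - exact: ltNyr.
  - exact: (@continuous_normal_pdf R 0 1 (oner_neq0 _) x).
  by rewrite derive1E => E; apply: DeriveDef.
rewrite /ntail; have := @is_deriveB R R R (cst 1) (@Phi R) x 1 0 (npdf x) _ F.
by rewrite sub0r; exact.
Qed.

Lemma Phi_ge0 x : 0 <= Phi x.
Proof. by rewrite fine_ge0. Qed.

Lemma Phi_le1 x : Phi x <= 1.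
Proof.
pose P : probability (measurableTypeR R) R := normal_prob 0 1.
have PE : Phi x = fine (P `]-oo, x]%classic) by [].
by rewrite PE -lee_fin fineK ?fin_num_measure// probability_le1.
Qed.

Lemma ntail_ge0 x : 0 <= ntail x.
Proof. by rewrite subr_ge0 Phi_le1. Qed.

Lemma ntail_le1 x : ntail x <= 1.
Proof. by rewrite gerBl Phi_ge0. Qed.

Lemma ntail_nincr x y : x <= y -> ntail y <= ntail x.
Proof.
move=> xy; apply: (@le0_derive_nincr R ntail (fun x => - npdf x) x y xy) => z _.
  exact: is_derive_ntail.
by rewrite oppr_le0 ltW// npdf_gt0.
Qed.

Let idR : measurableTypeR R -> R := idfun.

HB.instance Definition _ :=
  @isMeasurableFun.Build _ _ _ _ idR (@measurable_id _ _ setT).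

Lemma Phi_lim : Phi x @[x --> +oo%R] --> (1 : R) /\ Phi x @[x --> -oo%R] --> (0 : R).
Proof.
pose P : probability (measurableTypeR R) R := normal_prob 0 1.
have E : cdf (idR : {RV P >-> R}) = fun x => (Phi x)%:E.
  apply/funext => x; rewrite /cdf /distribution /pushforward/= preimage_id /Phi fineK//.
  by rewrite fin_num_measure.
have := cvg_cdfy1 (idR : {RV P >-> R}); have := cvg_cdfNy0 (idR : {RV P >-> R}).
by rewrite E => /fine_cvg L0 /fine_cvg L1; split.
Qed.

Lemma ntail_small e : 0 < e -> exists M, forall x, M <= x ->
  ntail x <= e /\ Phi (- x) <= e.
Proof.
have [/cvgrPdist_le L1 /cvgrPdist_le L0] := Phi_lim => e0.
have [M1 [_ H1]] := L1 e e0.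
have [M2 [_ H2]] := L0 e e0.
exists (Num.max (M1 + 1) (- M2 + 1)) => x; rewrite ge_max => /andP[a1 a2]; split.
  by have := H1 x; rewrite /ntail => /(_ _)/ler_normlW; apply; lra.
have := H2 (- x); rewrite sub0r normrN => /(_ _)/ler_normlW; apply; lra.
Qed.

(** The sum of the tails at x and -x has derivative zero, and it tends to
    one at infinity. *)
Lemma ntail0 : ntail 0 = 2^-1.
Proof.
have Dc (y : R) : is_derive y 1 (fun z => ntail z + ntail (- z)) 0.
  have ? := is_derive_ntail y.
  have ? : is_derive y 1 (fun z => ntail (- z)) (npdf y).
    have ? := is_derive_ntail (- y).
    have -> : npdf y = - npdf (- y) * - 1 by rewrite !npdfE sqrrN mulrN1 opprK.
    have ? : is_derive y 1 -%R (- 1 : R) by apply: is_derive_eq.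
    exact: (@is_derive1_comp R ntail -%R).
  by apply: is_derive_eq; rewrite addNr.
have S x : ntail x + ntail (- x) = ntail 0 + ntail 0.
  have := @is_derive_0_is_cst R _ x 0 Dc; rewrite oppr0; exact.
apply/eqP; rewrite -subr_eq0 -normr_le0; apply/ler_addgt0Pr => e e0; rewrite add0r.
have [M HM] := ntail_small e0.
have [h1 h2] := HM M (lexx M).
have := S M; have := ntail_ge0 M.
have : Phi (- M) >= 0 by rewrite fine_ge0.
have : ntail (- M) = 1 - Phi (- M) by [].
by move=> ? ? ? ?; rewrite ler_norml; apply/andP; split; lra.
Qed.

Lemma npdf_le x : npdf x <= 2^-1.
Proof.
apply: le_trans (normal_pdf_ub 0 x (oner_neq0 R)) _.
rewrite /normal_peak lef_pV2 ?posrE ?sqrtr_gt0//; last first.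
  by rewrite expr1n mul1r mulrn_wgt0 ?pi_gt0.
have -> : 2 = Num.sqrt (2 ^+ 2) :> R by rewrite sqrtr_sqr ger0_norm.
rewrite expr1n mul1r ler_wsqrtr//; have := @pi_ge2 R; lra.
Qed.

(** Mills' inequality: the tail minus npdf x / (1 + x) is nonincreasing on
    the positive axis.  If it were ever negative it would stay below a negative
    constant, while the density over 1 + x tends to zero. *)
Lemma mills x : 0 <= x -> npdf x <= (1 + x) * ntail x.
Proof.
move=> x0; rewrite leNgt; apply/negP => lt_tail.
pose D y := ntail y - npdf y * (1 + y)^-1.
have x1 : 0 < 1 + x by lra.
have Dx : D x < 0.
  by rewrite subr_lt0 ltr_pdivlMr// mulrC.
(* At M the density over 1 + M, at most 1/(2(1 + M)), is below - D x. *)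
pose M := x + (- D x)^-1.
have xM : x <= M by rewrite lerDl invr_ge0; lra.
have : D M <= D x.
  apply: (@le0_derive_nincr _ D (fun y => - npdf y + y * npdf y * (1 + y)^-1
    + npdf y * ((1 + y)^-1) ^+ 2)) => // y /andP[xy _].
    have y1 : 1 + y != 0 by apply/eqP; lra.
    have ? := is_derive_ntail y; have ? := is_derive_npdf y.
    rewrite /D; apply: is_derive_eq; rewrite /GRing.scale/= -exprVn; lra.
  have y1 : 0 < 1 + y by lra.
  have -> : - npdf y + y * npdf y * (1 + y)^-1 + npdf y * ((1 + y)^-1) ^+ 2 =
    - (npdf y * y * ((1 + y)^-1) ^+ 2) by field; apply/eqP; lra.
  rewrite oppr_le0 mulr_ge0 ?sqr_ge0// mulr_ge0 ?(ltW (npdf_gt0 _))//; lra.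
have M1 : 0 < 1 + M by lra.
suff : npdf M * (1 + M)^-1 < - D x 
  by have -> : D M = ntail M - npdf M * (1 + M)^-1 by []; have := ntail_ge0 M; lra.
rewrite ltr_pdivrMr//; apply: le_lt_trans (npdf_le M) _.
have : - D x * (- D x)^-1 = 1 by rewrite divff//; apply/eqP; lra.
have : 0 <= - D x * (1 + x) by rewrite mulr_ge0; lra.
have -> : - D x * (1 + M) = - D x * (1 + x) + - D x * (- D x)^-1.
  by rewrite -mulrDr addrA.
by move=> ? ->; lra.
Qed.

Lemma ntail_gt0 x : 0 < ntail x.
Proof.
have [x0|x0] := leP x 0.
  by apply: lt_le_trans (ntail_nincr x0); rewrite ntail0; lra.
have := mills (ltW x0); have := npdf_gt0 x => p /(lt_le_trans p).
by rewrite pmulr_rgt0//; lra.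
Qed.

(** For u <= 0 the hazard rate is at most one, because the
    density is at most 1/2 there and the tail at least 1/2. *)
Lemma npdf_le_ntail x u : 0 <= x -> u <= x -> npdf u <= (1 + x) * ntail u.
Proof.
move=> x0 ux; have t0 := ntail_ge0 u; have [u0|u0] := leP u 0.
  have := npdf_le u; have := ntail_nincr u0; rewrite ntail0.
  have : 0 <= x * ntail u by rewrite mulr_ge0.
  lra.
apply: le_trans (mills (ltW u0)) _.
by rewrite ler_wpM2r// lerD2l.
Qed.

(** The hazard rate bounds the logarithmic derivative of the tail: by
    [npdf_le_ntail], u |-> ntail u * expR ((1 + x) * u) is nondecreasing up to x. *)
Lemma ntail_shift x d : 0 <= x -> 0 <= d ->
  ntail (x - d) <= ntail x * expR ((1 + x) * d).
Proof.
move=> x0 d0; pose f u := ntail u * expR ((1 + x) * u).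
have : f (x - d) <= f x.
  apply: (@ge0_derive_ndecr _ f (fun u => expR ((1 + x) * u) *
     ((1 + x) * ntail u - npdf u))) => [|u _|u /andP[_ ux]]; first by lra.
    have ? := is_derive_ntail u; rewrite /f; apply: is_derive_eq.
    rewrite /GRing.scale/=; lra.
  by rewrite mulr_ge0 ?expR_ge0// subr_ge0 npdf_le_ntail.
have -> : (1 + x) * d = (1 + x) * x - (1 + x) * (x - d) by lra.
by rewrite /f expRD expRN mulrA ler_pdivlMr ?expR_gt0.
Qed.

(** The integral of (1 + v)^4 npdf v over v >= u, in closed form.  It controls
    the fourth-order error of the local approximation; the shift by one absorbs
    the distance from a lattice point to the points of the preceding cell. *)
Definition tail4 (u : R) := (u ^+ 3 + 4 * u ^+ 2 + 9 * u + 12) * npdf u + 10 * ntail u.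

Lemma is_derive_tail4 u : is_derive u 1 tail4 (- ((1 + u) ^+ 4 * npdf u)).
Proof.
have ? := is_derive_ntail u; have ? := is_derive_npdf u.
rewrite /tail4; apply: is_derive_eq; rewrite /GRing.scale/=; ring.
Qed.

Lemma tail4_nincr x y : x <= y -> tail4 y <= tail4 x.
Proof.
move=> xy; apply: (@le0_derive_nincr R tail4
  (fun u => - ((1 + u) ^+ 4 * npdf u)) x y xy) => z _.
  exact: is_derive_tail4.
by rewrite oppr_le0; apply: mulr_ge0; [exact: exprn_even_ge0|exact/ltW/npdf_gt0].
Qed.

Lemma tail4_ge0 u : 0 <= tail4 u.
Proof.
apply: (le_trans _ (tail4_nincr (_ : u <= Num.max 0 u))); last first.
  by rewrite le_max lexx orbT.
have : 0 <= Num.max 0 u by rewrite le_max lexx.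
move: (Num.max 0 u) => v v0.
by rewrite /tail4 addr_ge0// mulr_ge0 ?ntail_ge0 ?(ltW (npdf_gt0 _))//
  !addr_ge0// !mulr_ge0// exprn_ge0.
Qed.

Lemma tail4_le u : 0 <= u -> tail4 u <= 22 * (1 + u) ^+ 4 * ntail u.
Proof.
move=> u0; rewrite /tail4.
have c0 : 0 <= u ^+ 3 + 4 * u ^+ 2 + 9 * u + 12 by nra.
have := ler_wpM2l c0 (mills u0).
have : (u ^+ 3 + 4 * u ^+ 2 + 9 * u + 12) * (1 + u) + 10 <= 22 * (1 + u) ^+ 4 by nra.
move/(ler_wpM2r (ntail_ge0 u)); lra.
Qed.

End NormalTail.

(** * Central binomial coefficients *)

Section Binomial.
Context {R : realType}.
Implicit Types u : R.

Lemma expR_ge1Dx_sqr u : 0 <= u -> 1 + u + u ^+ 2 / 2 <= expR u.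
Proof.
move=> u0; rewrite -subr_ge0.
pose f x : R := expR x - (1 + x + x ^+ 2 / 2).
have f0 : f 0 = 0 by rewrite /f expR0; lra.
rewrite -[leLHS]f0.
apply: (@ge0_derive_ndecr R f (fun x => expR x - (1 + x)) 0 u) => // [x _|x _].
  by rewrite /f; apply: is_derive_eq; rewrite /GRing.scale/=; lra.
by rewrite subr_ge0 expR_ge1Dx.
Qed.

(** After multiplication by expR u the difference of the two sides has
    derivative u * (expR u - expR (- u)), which is nonnegative. *)
Lemma sub_le_add_expR u : 0 <= u -> 1 - u <= (1 + u) * expR (- (2 * u)).
Proof.
move=> u0.
pose f x : R := (1 + x) * expR (- x) - (1 - x) * expR x.
have f0 : f 0 = 0 by rewrite /f oppr0 expR0; lra.
have : f 0 <= f u.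
  apply: (@ge0_derive_ndecr R f (fun x => x * (expR x - expR (- x))) 0 u)
    => // [x _|x /andP[x0 _]].
    by rewrite /f; apply: is_derive_eq; rewrite /GRing.scale/=; lra.
  by rewrite mulr_ge0// subr_ge0 ler_expR; lra.
rewrite f0 subr_ge0 => /(ler_wpM2r (expR_ge0 (- u))).
rewrite -!mulrA -!expRD subrr expR0 mulr1.
by have -> : - u - u = - (2 * u) by lra.
Qed.

(** Since 1 - u^3 = (1 - u)(1 + u + u^2), this reduces to
    (1 + u)(1 + u + u^2) <= expR (2u), and the left side is at most the
    square of 1 + u + u^2/2. *)
Lemma sub_ge_add_expR u : 0 <= u <= 1 ->
  (1 + u) * (expR (- (2 * u)) * (1 - u ^+ 3)) <= 1 - u.
Proof.
move=> /andP[u0 u1].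
have e2 : (1 + u) * (1 + u + u ^+ 2) <= expR (2 * u).
  have -> : 2 * u = u + u by lra.
  have e1 := expR_ge1Dx_sqr u0; rewrite expRD.
  have : 0 <= 1 + u + u ^+ 2 / 2 by nra.
  by move=> p0; have := ler_pM p0 p0 e1 e1; nra.
rewrite mulrCA expRN ler_pdivrMl ?expR_gt0//.
have -> : (1 + u) * (1 - u ^+ 3) = (1 + u) * (1 + u + u ^+ 2) * (1 - u) by ring.
by rewrite ler_wpM2r//; lra.
Qed.

Variable h : nat.
Local Notation N := ((2 * h + 1)%:R : R).

Definition central_ratio (l : nat) : R := 'C(2 * h, h + l)%:R / 'C(2 * h, h)%:R.

Lemma central_bin_gt0 : 0 < 'C(2 * h, h)%:R :> R.
Proof. by rewrite ltr0n bin_gt0 leq_pmull. Qed.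

Lemma central_ratio0 : central_ratio 0 = 1.
Proof. by rewrite /central_ratio addn0 divff// gt_eqF// central_bin_gt0. Qed.

Lemma central_ratio_ge0 l : 0 <= central_ratio l.
Proof. by rewrite divr_ge0. Qed.

Let N_gt0 : 0 < N. Proof. by rewrite ltr0n addn1. Qed.
Let NE : N = 2 * h%:R + 1. Proof. by rewrite natrD natrM. Qed.
Let u l : R := (2 * l%:R + 1) / N.

Lemma central_ratioS l : (l <= h)%N ->
  (1 + u l) * central_ratio l.+1 = (1 - u l) * central_ratio l.
Proof.
move=> lh; rewrite /central_ratio !mulrA; congr (_ / _).
have E := mul_bin_left (2 * h) (h + l).
have {E} : ((h + l).+1 * 'C(2 * h, (h + l).+1))%:R
    = ((2 * h - (h + l)) * 'C(2 * h, h + l))%:R :> R by rewrite E.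
rewrite -addnS !natrM natrB; last by rewrite mul2n -addnn leq_add2l.
rewrite natrM !natrD -[(l.+1)%:R]natr1 => E.
have N0 : 2 * h%:R + 1 != 0 :> R by have := N_gt0; rewrite natrD natrM => /lt0r_neq0.
have -> : 1 + u l = 2 * (h%:R + (l%:R + 1)) / N by rewrite /u natrD natrM; field.
have -> : 1 - u l = 2 * (2 * h%:R - (h%:R + l%:R)) / N by rewrite /u natrD natrM; field.
transitivity (2 / N * ((h%:R + (l%:R + 1)) * 'C(2 * h, h + l.+1)%:R)); first by ring.
by rewrite E; ring.
Qed.

Lemma central_ratio_out l : (h < l)%N -> central_ratio l = 0.
Proof.
by move=> hl; rewrite /central_ratio bin_small ?mul0r// mul2n -addnn ltn_add2l.
Qed.

Lemma u_ge0 l : 0 <= u l.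
Proof. by rewrite divr_ge0// addr_ge0// mulr_ge0. Qed.

Lemma u_le1 l : (l <= h)%N -> u l <= 1.
Proof.
by move=> lh; rewrite ler_pdivrMr// mul1r NE lerD2r ler_pM2l// ler_nat.
Qed.

(** The exponents add up: the sum of 2(2i+1)/(2h+1) over i < l is
    2 l^2/(2h+1). *)
Lemma central_ratio_le l : central_ratio l <= expR (- (2 * l%:R ^+ 2 / N)).
Proof.
elim: l => [|l IH].
  by rewrite central_ratio0 expr0n/= mulr0 mul0r oppr0 expR0.
have [lh|lh] := leqP l h; last first.
  by rewrite central_ratio_out ?expR_ge0// ltnW.
have p : 0 < 1 + u l by have := u_ge0 l; lra.
rewrite -(ler_pM2l p) central_ratioS//.
have -> : - (2 * l.+1%:R ^+ 2 / N) = - (2 * u l) + - (2 * l%:R ^+ 2 / N).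
  rewrite /u -natr1; field; exact: lt0r_neq0.
rewrite expRD [leRHS]mulrA; apply: (@ler_pM R (1 - u l) _ (central_ratio l));
  rewrite ?central_ratio_ge0//.
  by have := u_le1 lh; lra.
exact: sub_le_add_expR (u_ge0 l).
Qed.

(** The factors 1 - u_i^3 lost at each step multiply to at least one minus
    the sum of the u_i^3, which is at most 2 l^4/(2h+1)^3.  When the bracket is
    negative there is nothing to prove; this covers all l > h as well, so the
    bound holds without any restriction on l. *)
Lemma central_ratio_ge l :
  expR (- (2 * l%:R ^+ 2 / N)) * (1 - 2 * l%:R ^+ 4 / N ^+ 3) <= central_ratio l.
Proof.
have N0 : N != 0 := lt0r_neq0 N_gt0.
elim: l => [|l IH].
  by rewrite central_ratio0 !expr0n/= !mulr0 !mul0r oppr0 expR0 addr0 mulr1.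
pose E k : R := 2 * k%:R ^+ 4 / N ^+ 3; rewrite -/(E l.+1).
rewrite -/(E l) in IH.
have ES : E l + u l ^+ 3 <= E l.+1.
  rewrite /E /u -natr1 expr_div_n -mulrDl ler_wpM2r ?invr_ge0 ?exprn_ge0//.
  have : 0 <= l%:R :> R by []. nra.
have [lh|lh] := leqP l h; last first.
  apply: le_trans (central_ratio_ge0 _); rewrite mulr_ge0_le0 ?expR_ge0//.
  rewrite subr_le0; apply: le_trans ES.
  have : 1 <= u l ^+ 3.
    by rewrite exprn_ege1// ler_pdivlMr// mul1r NE lerD2r ler_pM2l// ler_nat ltnW.
  suff : 0 <= E l by lra.
  by rewrite /E divr_ge0 ?mulr_ge0 ?exprn_ge0 ?(ltW N_gt0).
have p : 0 < 1 + u l by have := u_ge0 l; lra.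
have [E1|E1] := leP (E l.+1) 1; last first.
  apply: le_trans (central_ratio_ge0 _); rewrite mulr_ge0_le0 ?expR_ge0//.
  by rewrite subr_le0 ltW.
rewrite -(ler_pM2l p) central_ratioS//.
have -> : - (2 * l.+1%:R ^+ 2 / N) = - (2 * u l) + - (2 * l%:R ^+ 2 / N).
  by rewrite /u -natr1; field.
have u0 := u_ge0 l; have u1 := u_le1 lh.
have El : 0 <= E l by rewrite /E divr_ge0 ?mulr_ge0 ?exprn_ge0 ?(ltW N_gt0).
have u3 : 0 <= u l ^+ 3 by rewrite exprn_ge0.
set G := expR (- (2 * l%:R ^+ 2 / N)) in IH *.
have G0 : 0 <= G := expR_ge0 _.
apply: le_trans (_ : (1 - u l) * (G * (1 - E l)) <= _); last first.
  by rewrite ler_wpM2l//; lra.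
have -> : (1 + u l) * (expR (- (2 * u l) + - (2 * l%:R ^+ 2 / N)) * (1 - E l.+1)) =
   G * ((1 + u l) * (expR (- (2 * u l)) * (1 - E l.+1))) by rewrite expRD -/G; ring.
rewrite [leRHS]mulrCA ler_wpM2l//.
apply: le_trans (_ : (1 + u l) * (expR (- (2 * u l)) * (1 - u l ^+ 3)) * (1 - E l) <= _).
  rewrite -!mulrA ler_wpM2l ?(ltW p)// ler_wpM2l ?expR_ge0//.
  nra.
by rewrite ler_wpM2r ?sub_ge_add_expR ?u0//; lra.
Qed.

End Binomial.

(** * Sums over a half line *)

Section Telescope.
Context {R : realType}.
Implicit Types (e : R -> R) (r : R) (m : nat).

(** The real threshold r need not be an integer: the first summand
    has an index in [r, r+1), where e no longer exceeds e r. *)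
Lemma telescope_le e r m : (forall x y, x <= y -> e y <= e x) ->
  \sum_(j < m | r <= j%:R) (e j%:R - e (j%:R + 1)) <= e r - e (Num.max r m%:R).
Proof.
move=> edec; elim: m => [|m IH].
  by rewrite big_ord0 subr_ge0 edec// le_max lexx.
rewrite big_mkcond big_ord_recr/= -big_mkcond/= -natr1.
apply: le_trans (lerD IH (lexx _)) _.
case: (leP r m%:R) => rm.
  by rewrite max_r; lra.
by rewrite addr0 lerD2l lerN2 edec// le_max lexx.
Qed.

Lemma telescope_ge e r m : -1 <= r -> (forall x y, x <= y -> e y <= e x) ->
  e (r + 1) - e (Num.max (r + 1) m%:R) <=
  \sum_(j < m | r <= j%:R) (e j%:R - e (j%:R + 1)).
Proof.
move=> r0 edec; elim: m => [|m IH].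
  by rewrite big_ord0 max_l ?subrr//; lra.
rewrite big_mkcond big_ord_recr/= -big_mkcond/= -natr1.
apply: le_trans (lerD IH (lexx _)).
case: (leP r m%:R) => rm.
  rewrite [Num.max _ (_ + 1)]max_r; last by lra.
  have : e (Num.max (r + 1) m%:R) <= e m%:R by rewrite edec// le_max lexx orbT.
  lra.
rewrite (@max_l _ R (r + 1) m%:R); last by lra.
by rewrite (@max_l _ R (r + 1) (m%:R + 1)); lra.
Qed.

End Telescope.

(** * Tails of the symmetric binomial law with an even number of trials *)

Section BinomialTail.
Context {R : realType}.
Implicit Types r x y : R.

(** The upper tail of Bin(n, 1/2), with a real threshold so that displacements
    need no rounding. *)
Definition bintail (n : nat) (r : R) : R :=
  (\sum_(j < n.+1 | r <= j%:R) 'C(n, j)%:R) / 2 ^+ n.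

Lemma ntail_cell (a b : R) : a <= b ->
  exists2 c, a <= c <= b & ntail a - ntail b = (b - a) * npdf c.
Proof.
move=> ab; have [c cab E] := mvt_cell ab is_derive_ntail.
by exists c => //; lra.
Qed.

Lemma ntail_lipschitz (a b : R) : a <= b -> ntail a - ntail b <= (b - a) / 2.
Proof.
move=> ab; have [c cab ->] := ntail_cell ab.
by rewrite ler_wpM2l ?npdf_le// subr_ge0.
Qed.

Lemma tail4_cell (a b : R) : a <= b ->
  exists2 c, a <= c <= b & tail4 a - tail4 b = (b - a) * ((1 + c) ^+ 4 * npdf c).
Proof.
move=> ab; have [c cab E] := mvt_cell ab is_derive_tail4.
by exists c => //; lra.
Qed.

Lemma bintail_ge0 n r : 0 <= bintail n r.
Proof. by rewrite divr_ge0 ?exprn_ge0// sumr_ge0. Qed.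

Lemma sum_bin n : \sum_(j < n.+1) 'C(n, j)%:R = 2 ^+ n :> R.
Proof. 
rewrite -[2]/(1 + 1) exprDn; apply: eq_bigr => i _.
by rewrite !expr1n mulr1.
Qed.

Lemma bintail_le0 n r : r <= 0 -> bintail n r = 1.
Proof.
move=> r0; rewrite /bintail (eq_bigl xpredT) => [|i]; last exact: le_trans r0 _.
by rewrite sum_bin divff// expf_neq0// pnatr_eq0.
Qed.

Lemma bintail_nincr n r s : r <= s -> bintail n s <= bintail n r.
Proof.
move=> rs; rewrite ler_wpM2r ?invr_ge0 ?exprn_ge0//.
rewrite big_mkcond [leRHS]big_mkcond ler_sum// => i _.
case: ifPn => [si|_]; first by rewrite (le_trans rs si).
by case: ifP.
Qed.

Lemma bintail_widen n m r : (n < m)%N ->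
  bintail n r = (\sum_(j < m | r <= j%:R) 'C(n, j)%:R) / 2 ^+ n.
Proof.
move=> nm; congr (_ / _).
rewrite (big_ord_widen_cond m (fun j => r <= j%:R) (fun j => 'C(n, j)%:R : R))//.
rewrite [RHS]big_mkcond [LHS]big_mkcond; apply: eq_bigr => i _.
case: (r <= _) => //=; case: ltnP => // ni.
by rewrite bin_small.
Qed.

Variable h : nat.
Local Notation N := ((2 * h + 1)%:R : R).
(** Distance between lattice points after standardization.  The variance is
    taken as (2h+1)/4 and not h/2: with this choice the upper Gaussian bound
    holds without any error term. *)
Definition mesh : R := 2 / Num.sqrt N.
Local Notation d := mesh.
Definition lattice y := (y - h%:R) * d.
(** The normalizing factor between the binomial weights and the Gaussian
    Riemann sum; its being close to one replaces Stirling's formula. *)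
Definition kappa : R := d * normal_peak 1 * 2 ^+ (2 * h) / 'C(2 * h, h)%:R.

Let N_gt0 : 0 < N. Proof. by rewrite ltr0n addn1. Qed.

Lemma mesh_gt0 : 0 < d.
Proof. by rewrite divr_gt0// sqrtr_gt0. Qed.

Lemma mesh_sqr : d ^+ 2 = 4 / N.
Proof. by rewrite /mesh expr_div_n sqr_sqrtr ?(ltW N_gt0)//; congr (_ / _); ring. Qed.

Lemma kappa_gt0 : 0 < kappa.
Proof.
have p := @normal_peak_gt0 R 1 (oner_neq0 _).
by rewrite divr_gt0 ?central_bin_gt0// !mulr_gt0 ?mesh_gt0// exprn_gt0.
Qed.

Lemma latticeS y : lattice (y + 1) = lattice y + d.
Proof. by rewrite /lattice; ring. Qed.

Lemma lattice_le x y : x <= y -> lattice x <= lattice y.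
Proof. by move=> xy; rewrite ler_wpM2r ?(ltW mesh_gt0)//; lra. Qed.

Lemma kappa_bintail r m : (2 * h < m)%N -> kappa * bintail (2 * h) r =
  \sum_(j < m | r <= j%:R) d * (normal_peak 1 * ('C(2 * h, j)%:R / 'C(2 * h, h)%:R)).
Proof.
move=> hm; rewrite (bintail_widen _ hm) /kappa.
rewrite [RHS](eq_bigr (fun j : 'I_m => d * normal_peak 1 / 'C(2 * h, h)%:R * 'C(2 * h, j)%:R));
  last by move=> j _; rewrite !mulrA mulrAC.
rewrite -mulr_sumr; field.
by rewrite !lt0r_neq0 ?exprn_gt0// central_bin_gt0.
Qed.

(** The points left of the centre are handled by the symmetry of the
    binomial coefficients. *)
Lemma bin_term_le j :
  normal_peak 1 * ('C(2 * h, j)%:R / 'C(2 * h, h)%:R) <= npdf (lattice j%:R).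
Proof.
have p := @normal_peak_ge0 R 1.
have main l :
    normal_peak 1 * ('C(2 * h, h + l)%:R / 'C(2 * h, h)%:R) <= npdf (lattice (h + l)%:R).
  rewrite npdfE ler_wpM2l//.
  apply: le_trans (central_ratio_le h l) _.
  rewrite ler_expR /lattice exprMn mesh_sqr (natrD _ h l).
  suff -> : - (((h%:R + l%:R - h%:R) ^+ 2 * (4 / N))) / 2 = - (2 * l%:R ^+ 2 / N) by [].
  have := lt0r_neq0 N_gt0; set n := N => n0; by field.
have [hj|jh] := leqP h j; first by rewrite -(subnKC hj).
have jh2 : (j <= 2 * h)%N by lia.
rewrite -(bin_sub jh2) (_ : 2 * h - j = h + (h - j))%N; last by lia.
apply: le_trans (main _) _; apply: npdf_anti.
rewrite /lattice natrD natrB ?(ltnW jh)//.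
suff -> : ((j%:R - h%:R) * d) ^+ 2 = ((h%:R + (h%:R - j%:R) - h%:R) * d) ^+ 2 by [].
ring.
Qed.

Lemma bin_term_ge j : (h <= j)%N ->
  npdf (lattice j%:R) * (1 - lattice j%:R ^+ 4 / (8 * N)) <=
  normal_peak 1 * ('C(2 * h, j)%:R / 'C(2 * h, h)%:R).
Proof.
move=> hj; rewrite -(subnKC hj); move: (j - h)%N => l.
rewrite npdfE -mulrA ler_wpM2l ?normal_peak_ge0//.
apply: le_trans (central_ratio_ge h l).
have -> : lattice (h + l)%:R ^+ 4 = (lattice (h + l)%:R ^+ 2) ^+ 2 by ring.
have -> : lattice (h + l)%:R ^+ 2 = l%:R ^+ 2 * (4 / N).
  by rewrite /lattice exprMn mesh_sqr (natrD _ h l); ring.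
have n0 := lt0r_neq0 N_gt0; set n := N in n0 *.
have -> : - (l%:R ^+ 2 * (4 / n)) / 2 = - (2 * l%:R ^+ 2 / n) by field.
by have -> : (l%:R ^+ 2 * (4 / n)) ^+ 2 / (8 * n) = 2 * l%:R ^+ 4 / n ^+ 3 by field.
Qed.

(** Every Gaussian weight is bounded by a difference of values of a
    nonincreasing function E, and the sum telescopes.  On the right of the centre the
    density decreases, so the weight at t is below the integral over the cell
    ending at t; on the left it is below the integral over the cell starting at t.
    The two families of cells leave room for one extra point at the centre, which
    is why E is raised by the mesh on the left. *)
Lemma kappa_bintail_le r :
  kappa * bintail (2 * h) r <= (1 + 2 * d) * ntail (lattice (r - 1)).
Proof.
have d0 := mesh_gt0.
rewrite (kappa_bintail r (leqnn (2 * h).+1)).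
(* For t > 0 the cell ends at t, for t <= 0 it starts there. *)
pose E t := if 0 < t then ntail (t - d) else ntail t + d.
have E0 t : 0 <= E t by rewrite /E; case: ifP; rewrite ?ntail_ge0// addr_ge0 ?ntail_ge0// ltW.
have Edec s t : s <= t -> E t <= E s.
  rewrite /E => st; case: ltP => t0; case: ltP => s0.
  - by apply: ntail_nincr; lra.
  - have := @ntail_lipschitz (t - d) t; have := ntail_nincr st; lra.
  - by exfalso; lra.
  - by have := ntail_nincr st; lra.
apply: le_trans (_ : \sum_(j < (2 * h).+1 | r <= j%:R)
   (E (lattice j%:R) - E (lattice (j%:R + 1))) <= _).
  apply: ler_sum => j _; apply: le_trans (_ : d * npdf (lattice j%:R) <= _).
    by rewrite ler_wpM2l ?(ltW d0)// bin_term_le.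
  rewrite latticeS; have [jh|hj|jh] := ltngtP j h.
  - have a : lattice j%:R + d <= 0.
      rewrite -latticeS natr1 -[leRHS](mul0r d) ler_wpM2r ?(ltW d0)//.
      by rewrite subr_le0 ler_nat.
    rewrite /E !ifF; [|by apply/negbTE; rewrite -leNgt; lra..].
    have [c cab] := @ntail_cell (lattice j%:R) (lattice j%:R + d) ltac:(lra).
    have -> : lattice j%:R + d - lattice j%:R = d by ring.
    suff : d * npdf (lattice j%:R) <= d * npdf c by lra.
    rewrite ler_wpM2l ?(ltW d0)//; apply: npdf_anti; nra.
  - have a : d <= lattice j%:R.
      rewrite -[leLHS]mul1r ler_wpM2r ?(ltW d0)//.
      by rewrite lerBrDr nat1r ler_nat.
    rewrite /E !ifT; [|lra|lra].
    have [c cab] := @ntail_cell (lattice j%:R - d) (lattice j%:R) ltac:(lra).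
    have -> : lattice j%:R - (lattice j%:R - d) = d by ring.
    have -> : lattice j%:R + d - d = lattice j%:R by ring.
    move=> ->; rewrite ler_wpM2l ?(ltW d0)//; apply: npdf_anti; nra.
  - rewrite jh /lattice subrr mul0r add0r /E ltxx d0 subrr.
    have := npdf_le (0 : R); nra.
apply: le_trans (telescope_le r (2 * h).+1 (e := E \o lattice) _) _.
  by move=> x y xy; apply: Edec; exact: lattice_le.
apply: (@le_trans _ _ (E (lattice r))); first by rewrite gerBl /= E0.
have -> : lattice r = lattice (r - 1) + d by rewrite -latticeS subrK.
have := ntail_ge0 (lattice (r - 1)).
rewrite /E; case: ltP => t0 tp.
  by rewrite addrK; nra.
have : ntail (lattice (r - 1) + d) <= ntail (lattice (r - 1)) by apply: ntail_nincr; lra.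
have : ntail 0 <= ntail (lattice (r - 1)) by apply: ntail_nincr; lra.
rewrite ntail0; nra.
Qed.

(** On the right of the centre the weight at t is above the integral over the
    cell starting at t, which gives the main term, and t^4 times it is below the
    integral of (1 + v)^4 npdf v over the cell ending at t, which gives the error
    term.  Summing beyond 2h costs nothing as the binomial coefficients vanish, so
    the remainder of the Gaussian tail can be made arbitrarily small. *)
Lemma kappa_bintail_ge r : d <= 1 -> h%:R + 1 <= r ->
  ntail (lattice (r + 1)) - tail4 (lattice (r - 1)) / (8 * N) <= kappa * bintail (2 * h) r.
Proof.
move=> d1 hr; have d0 := mesh_gt0.
apply/ler_addgt0Pr => eps eps0.
have [M HM] := ntail_small eps0.
(* Beyond every binomial index, and far enough for the tail to be below eps. *)
pose m := maxn (2 * h).+1 (h + Num.truncn (M / d)).+1.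
have hm : (2 * h < m)%N by rewrite leq_max ltnSn.
have Mm : M <= lattice m%:R.
  rewrite /lattice -ler_pdivrMr// lerBrDr; apply: ltW.
  apply: lt_le_trans (_ : (h + Num.truncn (M / d)).+1%:R <= _).
    rewrite -addnS natrD addrC ltrD2l; exact: truncnS_gt.
  by rewrite ler_nat leq_maxr.
rewrite (kappa_bintail r hm).
have jr (j : 'I_m) : r <= j%:R -> d <= lattice j%:R.
  move=> rj; rewrite -[leLHS]mul1r ler_wpM2r ?(ltW d0)//; lra.
apply: le_trans (_ : \sum_(j < m | r <= j%:R)
   ((ntail (lattice j%:R) - ntail (lattice (j%:R + 1))) -
    (tail4 (lattice (j%:R - 1)) - tail4 (lattice (j%:R + 1 - 1))) / (8 * N)) + eps <= _);
  last first.
  rewrite lerD2r; apply: ler_sum => j /[dup] rj /jr dj.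
  have hj : (h <= j)%N by rewrite -(ler_nat R); lra.
  apply: le_trans (_ : d * (npdf (lattice j%:R) * (1 - lattice j%:R ^+ 4 / (8 * N))) <= _);
    last first.
    by rewrite ler_wpM2l ?(ltW d0)// bin_term_ge.
  rewrite addrK latticeS.
  have pS : lattice j%:R = lattice (j%:R - 1) + d by rewrite -latticeS subrK.
  have [c cab ->] := @ntail_cell (lattice j%:R) (lattice j%:R + d) ltac:(lra).
  have [b bab ->] := @tail4_cell (lattice (j%:R - 1)) (lattice j%:R) ltac:(lra).
  have -> : lattice j%:R + d - lattice j%:R = d by ring.
  have -> : lattice j%:R - lattice (j%:R - 1) = d by lra.
  rewrite -!(mulrA d) -mulrBr ler_wpM2l ?(ltW d0)//.
  have i0 : 0 <= (8 * N)^-1 by rewrite invr_ge0 mulr_ge0// ltW.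
  have n1 : npdf c <= npdf (lattice j%:R) by apply: npdf_anti; nra.
  have n2 : npdf (lattice j%:R) <= npdf b by apply: npdf_anti; nra.
  have p4 : lattice j%:R ^+ 4 <= (1 + b) ^+ 4 by rewrite lerXn2r ?nnegrE//; lra.
  have p4P := ler_pM (exprn_ge0 4 (_ : 0 <= lattice j%:R))
    (ltW (npdf_gt0 (lattice j%:R))) p4 n2.
  have {p4P} : lattice j%:R ^+ 4 * npdf (lattice j%:R) <= (1 + b) ^+ 4 * npdf b.
    by apply: p4P; lra.
  move/(ler_wpM2r i0); move: i0 n1; set i := (8 * N)^-1 => i0 n1; lra.
rewrite sumrB -mulr_suml.
have := @telescope_ge R (ntail \o lattice) r m.
have := @telescope_le R (fun y => tail4 (lattice (y - 1))) r m.
move=> T4 T0.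
have {T4} := T4 (fun x y xy => tail4_nincr (lattice_le (lerB xy (lexx 1)))).
have {T0} := T0 _ (fun x y xy => ntail_nincr (lattice_le xy)).
have h0 : 0 <= h%:R :> R by [].
move=> /(_ ltac:(lra))/= T0 T4.
have {T4} := le_trans T4 (_ : _ <= tail4 (lattice (r - 1))).
rewrite gerBl tail4_ge0 => /(_ isT) T4.
have i0 : 0 <= (8 * N)^-1 by rewrite invr_ge0 mulr_ge0// ltW.
have {T4} := ler_wpM2r i0 T4.
have MM : M <= lattice (Num.max (r + 1) m%:R).
  by apply: le_trans Mm _; apply: lattice_le; rewrite le_max lexx orbT.
have [+ _] := HM _ MM.
move: T0; set A := \sum_(_ < _ | _) _; set B := \sum_(_ < _ | _) _.
set i := (8 * N)^-1; lra.
Qed.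

(** The binomial coefficients are symmetric, and the central one is left over. *)
Lemma half_bintail : 2 * bintail (2 * h) (h%:R + 1) <= 1.
Proof.
rewrite mulrA ler_pdivrMr ?exprn_gt0// mul1r -sum_bin.
rewrite [leRHS](bigID (fun j : 'I_(2 * h).+1 => h%:R + 1 <= j%:R :> R))/=.
rewrite mulr_natl mulr2n lerD2l.
rewrite (reindex_inj rev_ord_inj)/= big_mkcond [leRHS]big_mkcond.
apply: ler_sum => j _.
have jn : (j <= 2 * h)%N by rewrite -ltnS.
rewrite subSS bin_sub// !natr1 !ler_nat.
case: ifPn => [hj|_]; last by case: ifP.
by rewrite ifT//; lia.
Qed.

(** The upper bound applied to the whole mass. *)
Lemma kappa_le : kappa <= 1 + 2 * d.
Proof.
have := kappa_bintail_le 0; rewrite bintail_le0// mulr1 => /le_trans; apply.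
by rewrite ler_piMr ?ntail_le1//; have := mesh_gt0; lra.
Qed.

(** The lower bound applied to the right half, whose mass is at most 1/2. *)
Lemma kappa_ge : d <= 1 -> 1 - 3 * d <= kappa.
Proof.
move=> d1; have d0 := mesh_gt0.
have := kappa_bintail_ge d1 (lexx _); have := half_bintail.
have -> : lattice (h%:R + 1 + 1) = 2 * d by rewrite /lattice; ring.
have -> : lattice (h%:R + 1 - 1) = 0 by rewrite /lattice addrK subrr mul0r.
have := kappa_gt0; have := @ntail_lipschitz 0 (2 * d) ltac:(lra).
have := tail4_le (lexx (0 : R)); rewrite ntail0 addr0 expr1n => t4.
have -> : (8 * N)^-1 = d ^+ 2 / 32 by rewrite mesh_sqr invfM; lra.
move: (bintail _ _) => b; nra.
Qed.

Lemma bintail_upper r : d <= 6^-1 ->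
  bintail (2 * h) r <= (1 + 10 * d) * ntail (lattice (r - 1)).
Proof.
move=> d6; have d0 := mesh_gt0; have d1 : d <= 1 by lra.
rewrite -(ler_pM2l kappa_gt0); apply: le_trans (kappa_bintail_le r) _.
rewrite [leRHS]mulrA ler_wpM2r ?ntail_ge0//.
have := kappa_ge d1; nra.
Qed.

(** The displacement of two cells in [kappa_bintail_ge] is absorbed by
    [ntail_shift]; the factor 1 + 2 mesh stands for kappa. *)
Lemma bintail_lower r : d <= 1 -> h%:R + 1 <= r ->
  ntail (lattice (r - 1)) * (expR (- ((1 + lattice (r + 1)) * (2 * d)))
     - d ^+ 2 * (1 + lattice (r - 1)) ^+ 4) <= (1 + 2 * d) * bintail (2 * h) r.
Proof.
move=> d1 hr; have d0 := mesh_gt0.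
have p0 : 0 <= lattice (r - 1) by rewrite mulr_ge0 ?(ltW d0)//; lra.
apply: (@le_trans _ _ (kappa * bintail (2 * h) r)); last first.
  by rewrite ler_wpM2r ?bintail_ge0 ?kappa_le.
apply: le_trans (kappa_bintail_ge d1 hr).
have E : lattice (r - 1) = lattice (r + 1) - 2 * d by rewrite /lattice; ring.
have := @ntail_shift R (lattice (r + 1)) (2 * d) ltac:(lra) ltac:(lra).
rewrite -E -ler_pdivrMr ?expR_gt0// -expRN => S.
have := tail4_le p0.
have -> : (8 * N)^-1 = d ^+ 2 / 32 by rewrite mesh_sqr invfM; lra.
have q4 : 0 <= (1 + lattice (r - 1)) ^+ 4 * ntail (lattice (r - 1)).
  by rewrite mulr_ge0 ?ntail_ge0 ?exprn_ge0//; lra.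
move/(ler_wpM2r (_ : 0 <= d ^+ 2 / 32)) => /(_ ltac:(nra)).
have := mulr_ge0 (sqr_ge0 d) q4.
move: S; set n := ntail _; set n' := ntail _; set e := expR _.
set q := (1 + _) ^+ 4; set D := d ^+ 2.
lra.
Qed.

End BinomialTail.

(** * Counting codes with many ones *)

Section Counting.
Context {R : realType}.
Implicit Types (r : R) (N k m y : nat).

Lemma bintail_gt n r : n%:R < r -> bintail n r = 0.
Proof.
move=> nr; rewrite /bintail big_pred0 ?mul0r// => j; apply/negbTE; rewrite -ltNge.
by apply: le_lt_trans nr; rewrite ler_nat -ltnS.
Qed.

Lemma bintail_le1 n r : bintail n r <= 1.
Proof.
rewrite -(@bintail_le0 R n (Num.min r 0)) ?bintail_nincr ?ge_min ?lexx ?orbT//.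
Qed.

Lemma bintailS n r : bintail n.+1 r = (bintail n r + bintail n (r - 1)) / 2.
Proof.
rewrite (bintail_widen r (ltnW (leqnn n.+2))) /bintail -mulrDl exprSr invfM mulrA.
congr (_ * _ * _); rewrite big_mkcond big_ord_recl/= ?bin0.
rewrite [X in _ = X + _]big_mkcond [X in _ = X + _]big_ord_recl/= ?bin0 -addrA; congr (_ + _).
rewrite [X in _ = _ + X]big_mkcond -big_split/=; apply: eq_bigr => i _.
rewrite /bump/= add1n binS natrD.
have -> : (r - 1 <= i%:R) = (r <= i.+1%:R) by rewrite lerBlDr natr1.
by case: ifP => _; rewrite ?addr0.
Qed.

Variable c : nat -> nat.
Definition count_ge N r : R := \sum_(y < N) (r <= (c y)%:R)%R%:R.

Hypothesis count_ge_rec : forall m r, (1 <= m)%N ->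
  count_ge (2 * m) r = count_ge m r + count_ge m (r - 1).

Lemma count_ge_eq0 N r : count_ge N r = 0 -> forall y, (y < N)%N -> (c y)%:R < r.
Proof.
move=> N0 y yN; rewrite ltNge; apply/negP => ry.
have /(_ (Ordinal yN) isT)/eqP := psumr_eq0P (fun _ _ => ler0n _ _) N0.
by rewrite /= ry oner_eq0.
Qed.

Lemma count_ge_full N r : count_ge N r = N%:R -> forall y, (y < N)%N -> r <= (c y)%:R.
Proof.
move=> NN y yN.
have E : \sum_(y < N) (1 - (r <= (c y)%:R)%R%:R) = 0 :> R.
  by rewrite sumrB -/(count_ge N r) NN sumr_const card_ord subrr.
have p (i : 'I_N) : true -> 0 <= 1 - (r <= (c i)%:R)%R%:R :> R.
  by case: (r <= _); rewrite ?subrr ?subr0.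
have /(_ (Ordinal yN) isT)/eqP := psumr_eq0P p E.
by case: (r <= _); rewrite // subr0 oner_eq0.
Qed.

(** By the recursion and induction on k, the count of the elements of [0, 2^k)
    above any r > c 0 + k vanishes. *)
Lemma code_le k y : (y < 2 ^ k)%N -> (c y <= c 0%N + k)%N.
Proof.
have H : forall r, (c 0%N + k)%:R < r -> count_ge (2 ^ k) r = 0.
  elim: k => [|k IH] r hr.
    by rewrite /count_ge big_ord1/= leNgt -(addn0 (c 0%N)) hr.
  rewrite expnS count_ge_rec ?expn_gt0//.
  move: hr; rewrite addnS -natr1 => hr.
  by rewrite !IH ?addr0//; lra.
move=> yk; rewrite leqNgt; apply/negP => lt.
have := count_ge_eq0 (H (c y)%:R _) yk; rewrite ltr_nat => /(_ lt).
by rewrite ltxx.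
Qed.

(** Dually, the recursion forces all elements below 2^k to reach c 0. *)
Lemma code_ge y : (c 0%N <= c y)%N.
Proof.
have H k : forall r, r <= (c 0%N)%:R -> count_ge (2 ^ k) r = (2 ^ k)%:R.
  elim: k => [|k IH] r hr; first by rewrite /count_ge big_ord1/= hr.
  rewrite expnS count_ge_rec ?expn_gt0// !IH//; last by lra.
  by rewrite mul2n -addnn natrD.
by have := count_ge_full (H y _ (lexx _)) (ltn_expl y (ltnSn 1)); rewrite ler_nat.
Qed.

(** The weight w i is 2^(k-i) if the corresponding binary digit of N is set
    and 0 otherwise.  Induction on k, halving N: doubling an interval convolves its
    law with a Bernoulli variable, which is Pascal's rule on the binomial side.  An odd
    N leaves one extra element 2m, which joins with the index k + 1; there the
    displaced binomial tails are 0 or 1 exactly as [code_le] and [code_ge] demand. *)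
Lemma count_ge_mixture k N : (N <= 2 ^ k)%N ->
  exists w : nat -> nat, [/\ (\sum_(i < k.+1) w i = N)%N,
    forall i, (i <= k)%N -> (w i <= 2 ^ (k - i))%N &
    forall r,
    \sum_(i < k.+1) (w i)%:R * bintail k (r - (c 0%N)%:R + i%:R) <= count_ge N r
      <= \sum_(i < k.+1) (w i)%:R * bintail k (r - (c 0%N)%:R - i%:R)].
Proof.
elim: k N => [|k IH] N Nk.
  exists (fun _ => N); split=> [|i _|r]; rewrite ?big_ord1//.
  have [->|->] : (N = 0 \/ N = 1)%N by move: Nk; rewrite expn0; lia.
    by rewrite /count_ge big_ord0 !mul0r lexx.
  rewrite /count_ge big_ord1 /= !mul1r addr0 subr0.
  have [rc|rc] := leP r (c 0%N)%:R; last by rewrite bintail_gt ?lexx//; lra.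
  by rewrite bintail_le0 ?lexx//; lra.
pose m := N./2; have NE : N = (2 * m + odd N)%N by rewrite /m; lia.
have mk : (m <= 2 ^ k)%N by move: Nk; rewrite expnS; lia.
have [w [wm wk wb]] := IH m mk.
pose w' i := if (i < k.+1)%N then (2 * w i)%N else odd N : nat.
exists w'; split=> [|i ik|r].
- rewrite big_ord_recr/= /w' ltnn (eq_bigr (fun i : 'I_k.+1 => 2 * w i)%N)
    => [|i _]; last first.
    by rewrite ltn_ord.
  by rewrite -big_distrr/= wm -NE.
- rewrite /w'; case: ltnP => ik'; last by rewrite (leq_trans (leq_b1 _))// expn_gt0.
  by rewrite subSn// expnS leq_mul2l wk.
have cE : count_ge N r = count_ge m r + count_ge m (r - 1) +
    (odd N)%:R * (r <= (c (2 * m)%N)%:R)%R%:R.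
  have -> : count_ge m r + count_ge m (r - 1) = count_ge (2 * m) r.
    have [->|m0] := posnP m; first by rewrite /count_ge !big_ord0 addr0.
    by rewrite count_ge_rec.
  rewrite {1}NE; case: (odd N); last by rewrite addn0 mul0r addr0.
  by rewrite addn1 /count_ge big_ord_recr/= mul1r.
have sE (f : nat -> R) : \sum_(i < k.+2) (w' i)%:R * bintail k.+1 (f i) =
  \sum_(i < k.+1) (w i)%:R * bintail k (f i) +
  \sum_(i < k.+1) (w i)%:R * bintail k (f i - 1) + (odd N)%:R * bintail k.+1 (f k.+1).
  rewrite big_ord_recr/= {2}/w' ltnn; congr (_ + _).
  rewrite -big_split/=; apply: eq_bigr => i _.
  by rewrite /w' ltn_ord bintailS natrM; field.
have /andP[l1 u1] := wb r; have /andP[l2 u2] := wb (r - 1).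
rewrite cE !(sE (fun i => r - (c 0%N)%:R + i%:R)) !(sE (fun i => r - (c 0%N)%:R - i%:R)).
apply/andP; split.
  apply: lerD; first (apply: lerD => //; apply: le_trans l2; apply: ler_sum => i _).
    by rewrite (_ : r - 1 - (c 0%N)%:R + i%:R = r - (c 0%N)%:R + i%:R - 1)//; ring.
  rewrite ler_wpM2l//; have [rc|rc] := leP r (c 0%N)%:R.
    have -> : r <= (c (2 * m)%N)%:R by rewrite (le_trans rc)// ler_nat code_ge.
    exact: bintail_le1.
  rewrite bintail_gt//; lra.
apply: lerD; first (apply: lerD => //; apply: le_trans u2 _; apply: ler_sum => i _).
  by rewrite (_ : r - 1 - (c 0%N)%:R - i%:R = r - (c 0%N)%:R - i%:R - 1)//; ring.
have [oN|] := boolP (odd N); last by rewrite !mul0r.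
rewrite !mul1r; have [rc|rc] := leP r (c (2 * m)%N)%:R; last exact: bintail_ge0.
rewrite bintail_le0//.
have := @code_le k.+1 (2 * m) ltac:(rewrite NE oN addn1 in Nk; exact: Nk).
rewrite -(ler_nat R) natrD; lra.
Qed.

End Counting.

(** * From laws to counts *)

Section Laws.
Context {R : realType}.
Variable code : nat -> seq bool.

Lemma uniform_upto_count_ge n (c : nat -> nat) (r : R) :
  uniform_upto n [set y | r <= (c y)%:R] = (count_ge c n.+1 r / n.+1%:R)%:E.
Proof.
rewrite /uniform_upto /mscale/= /msum mulrC EFinM; congr (_ * _)%E.
rewrite /count_ge -sumEFin; apply: eq_bigr => i _.
apply: etrans; first exact: diracE.
congr ((nat_of_bool _)%:R%:E).
by apply/idP/idP; rewrite inE.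
Qed.

Lemma add_bernoulli_halfE (mu : probability nat R) (B : set nat) :
  add_bernoulli_half mu B =
  (mu B * (2^-1)%:E + mu [set y | B y.+1] * (2^-1)%:E)%E.
Proof.
rewrite /add_bernoulli_half /pushforward.
have -> : (fun yi : nat * bool => (yi.1 + yi.2)%N) @^-1` B =
   (B `*` [set false]) `|` ([set y | B y.+1] `*` [set true]).
  apply/seteqP; split => -[y [|]]/=.
  - by rewrite addn1 => ?; right.
  - by rewrite addn0 => ?; left.
  - by move=> [[]//|[]]; rewrite addn1.
  - by move=> [[]|[]//]; rewrite addn0.
have h01 : 0 <= (2^-1 : R) <= 1 by lra.
rewrite measureU//=; last 3 first.
- exact: measurableX.
- exact: measurableX.
- by apply/seteqP; split=> // -[y b] /= [[_ /= ->] [_]].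
rewrite !product_measure1E//; congr (_ * _ + _ * _)%E.
- apply: etrans (bernoulli_probE h01 _) _; 
  rewrite !diracE memNset//= mem_set//= mule0 add0e mule1.
  by congr (_%:E); rewrite /unstable.onem; lra.
- apply: etrans (bernoulli_probE h01 _) _.
  by rewrite !diracE mem_set//= memNset//= mule0 adde0 mule1.
Qed.

Lemma ones_law_count_ge n (r : R) : ones_law R code n [set z : nat | r <= z%:R] =
  (count_ge (ones code) n.+1 r / n.+1%:R)%:E.
Proof. exact: uniform_upto_count_ge. Qed.

Lemma ones_count_ge_double (code_rec : forall m : nat, (1 <= m)%N ->
      ones_law R code (2 * m - 1) =
      add_bernoulli_half (ones_law R code (m - 1))) m (r : R) : (1 <= m)%N ->
  count_ge (ones code) (2 * m) r = count_ge (ones code) m r + count_ge (ones code) m (r - 1).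
Proof.
move=> m1; have := congr1 (fun mu => mu [set z : nat | r <= z%:R]) (code_rec m m1).
rewrite add_bernoulli_halfE.
have -> : [set y | [set z : nat | r <= z%:R] y.+1] = [set z : nat | r - 1 <= z%:R].
  by apply/seteqP; split => y /=; rewrite lerBlDr natr1.
rewrite /= !ones_law_count_ge.
rewrite !subn1 !prednK ?muln_gt0// => -[].
have m0 : m%:R != 0 :> R by rewrite pnatr_eq0 -lt0n.
move/(congr1 (fun z => z * (2 * m%:R))); rewrite natrM divfK ?mulf_neq0// => ->.
by field.
Qed.

End Laws.

(** * Moderate deviations of the symmetric binomial law *)

Section Assembly.
Context {R : realType}.
Implicit Types (r x : R) (k : nat).

Lemma bintail_leS n r : bintail n r <= bintail n.+1 r.
Proof.
rewrite bintailS; have := @bintail_nincr R n (r - 1) r ltac:(lra); lra.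
Qed.

Lemma bintailS_le n r : bintail n.+1 (r + 1) <= bintail n r.
Proof.
rewrite bintailS addrK; have := @bintail_nincr R n r (r + 1) ltac:(lra); lra.
Qed.

Lemma bintail_even k : exists h : nat, [/\ (k <= 2 * h <= k.+1)%N,
  forall r, bintail k r <= bintail (2 * h) r &
  forall r, bintail (2 * h) (r + 1) <= bintail k r].
Proof.
exists (uphalf k); rewrite mul2n; have [ok|ok] := boolP (odd k).
  have -> : (uphalf k).*2 = k.+1 by lia.
  by split=> [|r|r]; [lia|exact: bintail_leS|exact: bintailS_le].
have -> : (uphalf k).*2 = k by lia.
by split=> [|r|r]; [lia|exact: lexx|apply: bintail_nincr; lra].
Qed.

(** The standardization by sqrt k / 2 and the one by the mesh agree up to
    a relative error 2 / k. *)
Lemma mesh_bounds h k : (0 < k)%N -> (k <= 2 * h <= k.+1)%N ->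
  let s := Num.sqrt k%:R : R in
  mesh h * s <= 2 /\ 2 * k%:R - 4 <= mesh h * s * k%:R.
Proof.
move=> k0 kh s; have s0 : 0 < s by rewrite sqrtr_gt0 ltr0n.
have d0 := @mesh_gt0 R h.
have N0 : 0 < (2 * h + 1)%:R :> R by rewrite ltr0n addn1.
have s2 : s ^+ 2 = k%:R by rewrite sqr_sqrtr.
have : k.+1%:R <= ((2 * h + 1)%:R : R) <= k.+2%:R by rewrite !ler_nat; lia.
rewrite -(natr1 k.+1) -(natr1 k) => /andP[N1 N2].
have q2 : (mesh h * s) ^+ 2 * (2 * h + 1)%:R = 4 * k%:R.
  by rewrite exprMn mesh_sqr s2; field; exact: lt0r_neq0.
have kp : 0 < k%:R :> R by rewrite ltr0n.
have q0 : 0 < mesh h * s by rewrite mulr_gt0.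
move: q2 q0; set q := mesh h * s => q2 q0.
move: N0 N1 N2 q2; set N := (2 * h + 1)%:R => N0 N1 N2 q2.
have q1 : q <= 2.
  rewrite leNgt; apply/negP => q1.
  have : 4 < q ^+ 2 by nra.
  nra.
split=> //.
have : q ^+ 2 * k%:R + 8 >= 4 * k%:R by nra.
nra.
Qed.

(** The parameter c displaces the threshold to the left.  The rounding to an even
    number of trials, the change of scale and the cell of [bintail_upper] displace
    it by less than 3 more units. *)
Lemma bintail_le_ntail k x c : (0 < k)%N -> 12 <= Num.sqrt k%:R :> R ->
  0 <= x -> x <= Num.sqrt k%:R -> 0 <= c ->
  bintail k (k%:R / 2 + x * (Num.sqrt k%:R / 2) - c) <=
  (1 + 20 / Num.sqrt k%:R) * ntail x *
    expR ((1 + x) * (2 * (c + 3) / Num.sqrt k%:R)).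
Proof.
move=> k0 s12 x0 xs c0.
have [h [kh up _]] := bintail_even k; apply: le_trans (up _) _.
have [] := mesh_bounds k0 kh; have d0 := @mesh_gt0 R h.
have s2 : Num.sqrt k%:R ^+ 2 = k%:R :> R by rewrite sqr_sqrtr.
move: s12 xs s2; set s := Num.sqrt k%:R => s12 xs s2 q2 q4.
set d := mesh h in d0 q2 q4.
have sv : s * s^-1 = 1 by rewrite divff//; apply/eqP; lra.
have v0 : 0 < s^-1 by rewrite invr_gt0; lra.
set v := s^-1 in sv v0 *.
have dv : d <= 2 * v by nra.
have v12 : v <= 12^-1 by nra.
apply: le_trans (bintail_upper _ _) _; first by rewrite -/d; lra.
have hk : 2 * h%:R <= k%:R + 1 :> R by rewrite -natrM natr1 ler_nat; lia.
rewrite -/d.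
have P : x - 2 * (c + 3) * v <= lattice h (k%:R / 2 + x * (s / 2) - c - 1).
  rewrite /lattice -/d.
  have -> : (k%:R / 2 + x * (s / 2) - c - 1 - h%:R) * d =
    (k%:R / 2 - h%:R) * d + x * (d * s) / 2 - (c + 1) * d by field.
  have a1 : - 2^-1 * d <= (k%:R / 2 - h%:R) * d by rewrite ler_wpM2r ?(ltW d0)//; lra.
  have a2 : (c + 1) * d <= (c + 1) * (2 * v) by rewrite ler_wpM2l//; lra.
  have a3 : 2 - 4 * v ^+ 2 <= d * s.
    have : (2 * k%:R - 4) * v ^+ 2 <= d * s * k%:R * v ^+ 2 by rewrite ler_wpM2r// sqr_ge0.
    have -> : d * s * k%:R * v ^+ 2 = d * s * (s * v) ^+ 2 by rewrite -s2; ring.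
    have -> : (2 * k%:R - 4) * v ^+ 2 = 2 * (s * v) ^+ 2 - 4 * v ^+ 2 by rewrite -s2; ring.
    by rewrite sv expr1n !mulr1.
  have a4 : x * (2 - 4 * v ^+ 2) <= x * (d * s) by rewrite ler_wpM2l.
  have xv : x * v <= 1 by rewrite -sv ler_wpM2r// ltW.
  have : x * v * v <= 1 * v by rewrite ler_wpM2r// ltW.
  lra.
have S := @ntail_shift R x (2 * (c + 3) * v) x0 ltac:(nra).
have := le_trans (ntail_nincr P) S.
move=> T; rewrite -[leRHS]mulrA; apply: ler_pM => //; rewrite ?ntail_ge0//; lra.
Qed.

Lemma cube_convex x : 0 <= x -> (1 + x) ^+ 3 <= 4 * (1 + x ^+ 3).
Proof.
move=> x0; have : 0 <= (1 + x) * (1 - x) ^+ 2 by rewrite mulr_ge0 ?sqr_ge0 ?addr_ge0.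
lra.
Qed.

Lemma le_double_cube x : 0 <= x -> 1 + x <= 2 * (1 + x ^+ 3).
Proof.
move=> x0; have : 0 <= x * (x - 1) ^+ 2 by rewrite mulr_ge0 ?sqr_ge0.
have := sqr_ge0 (2 * x - 3 / 4); lra.
Qed.

(** In the budgets below v stands for 1 / sqrt k and a for the displacement of
    the threshold.  Errors are first compared with (1 + x) v, then with
    (1 + x^3) v. *)
Lemma shift_budget x v a y z : 0 <= x -> 0 <= v <= 2^-1 -> 3 <= a ->
  y <= x + 2 * (a * v) -> 0 <= y -> 0 <= z ->
  (1 + y) * (z * v) <= 3 * z * (a * ((1 + x) * v)).
Proof.
move=> x0 /andP[v0 v1] a3 yx y0 z0.
have av : a * v <= a * 2^-1 by rewrite ler_wpM2l//; lra.
have ax : x * 3 <= x * (3 * a) by rewrite ler_wpM2l//; lra.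
have -> : 3 * z * (a * ((1 + x) * v)) = (1 + x) * (3 * a) * (z * v) by ring.
by rewrite ler_wpM2r ?mulr_ge0//; lra.
Qed.

Lemma quartic_budget x v a d u : 0 <= x -> 0 <= v <= 2^-1 -> (1 + x) * v <= 1 ->
  3 <= a -> 0 <= d <= 2 * v -> 0 <= u -> u <= x + 2 * (a * v) ->
  d ^+ 2 * (1 + u) ^+ 4 <= 1296 * a ^+ 4 * ((1 + x ^+ 3) * v).
Proof.
move=> x0 /andP[v0 v1] ep1 a3 /andP[d0 dv] u0 ux.
have h1 : d ^+ 2 <= (2 * v) ^+ 2 by rewrite lerXn2r ?nnegrE// mulr_ge0.
have av : a * v <= a * 2^-1 by rewrite ler_wpM2l//; lra.
have ax : x * 3 <= x * (3 * a) by rewrite ler_wpM2l//; lra.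
have xa : 1 + u <= (1 + x) * (3 * a) by lra.
have h2 : (1 + u) ^+ 4 <= ((1 + x) * (3 * a)) ^+ 4.
  by rewrite lerXn2r ?nnegrE//; [lra|apply: le_trans xa; lra].
have u4 : 0 <= (1 + u) ^+ 4 by rewrite exprn_ge0// addr_ge0.
apply: le_trans (ler_pM (sqr_ge0 _) u4 h1 h2) _.
have -> : (2 * v) ^+ 2 * ((1 + x) * (3 * a)) ^+ 4 =
  324 * a ^+ 4 * ((1 + x) ^+ 3 * v) * ((1 + x) * v) by ring.
have a0 : 0 <= a by lra.
have x1 : 0 <= 1 + x by lra.
have a40 : 0 <= 324 * a ^+ 4 by apply: mulr_ge0; [exact: ler0n|exact: exprn_ge0].
have h3 : (1 + x) ^+ 3 * v <= 4 * (1 + x ^+ 3) * v by rewrite ler_wpM2r ?cube_convex.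
have h30 : 0 <= (1 + x) ^+ 3 * v by rewrite mulr_ge0 ?exprn_ge0.
apply: le_trans (ler_wpM2l (mulr_ge0 a40 h30) ep1) _.
rewrite mulr1; apply: le_trans (ler_wpM2l a40 h3) _.
have -> : 324 * a ^+ 4 * (4 * (1 + x ^+ 3) * v) = 1296 * a ^+ 4 * ((1 + x ^+ 3) * v).
  by ring.
exact: lexx.
Qed.

Lemma budget_sum (A B Q d v ep eta a : R) : 3 <= a -> 0 <= ep -> 0 <= eta ->
  A <= 6 * (a ^+ 2 * ep) -> B <= 12 * (a * ep) -> Q <= 1296 * a ^+ 4 * eta ->
  d <= 2 * v -> v <= ep -> ep <= 2 * eta ->
  A + (B + Q) + 2 * d <= 1400 * a ^+ 4 * eta.
Proof.
move=> a3 ep0 eta0 AA BB QQ dv vep epeta.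
have a0 : 0 <= a by lra.
have am : 0 <= a - 3 by lra.
have ap : 0 <= a + 3 by lra.
have a2 : 0 <= (a - 3) * (a * ep) by rewrite !mulr_ge0.
have a3' := ler_wpM2l (sqr_ge0 a) epeta.
have a4 : 0 <= (a - 3) * (a + 3) * (a ^+ 2 * eta) by rewrite !mulr_ge0.
have a5 : 0 <= (a - 3) * (a + 3) * eta by rewrite !mulr_ge0.
lra.
Qed.

Lemma error_budget x v a d u dl : 0 <= x -> 0 <= v <= 2^-1 -> (1 + x) * v <= 1 ->
  3 <= a -> 0 <= d <= 2 * v -> 0 <= u -> u <= x + dl ->
  0 <= dl -> dl <= 2 * (a * v) - 4 * v ->
  (1 + (x + dl)) * dl +
  ((1 + (u + 2 * d)) * (2 * d) + d ^+ 2 * (1 + u) ^+ 4) + 2 * d <=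
  1400 * a ^+ 4 * ((1 + x ^+ 3) * v).
Proof.
move=> x0 v01 ep1 a3 /andP[d0 dv] u0 ux dl0 dla.
have v0 : 0 <= v by case/andP: v01.
have B2 : d ^+ 2 * (1 + u) ^+ 4 <= 1296 * a ^+ 4 * ((1 + x ^+ 3) * v).
  by apply: quartic_budget => //; [rewrite d0|lra].
have av0 : 0 <= a * v by rewrite mulr_ge0//; lra.
have A1 : (1 + (x + dl)) * (2 * a * v) <= 3 * (2 * a) * (a * ((1 + x) * v)).
  by apply: shift_budget => //; lra.
have A2 : (1 + (x + dl)) * dl <= (1 + (x + dl)) * (2 * a * v).
  by rewrite ler_wpM2l//; lra.
have B1 : (1 + (u + 2 * d)) * (4 * v) <= 3 * 4 * (a * ((1 + x) * v)).
  by apply: shift_budget => //; lra.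
have B3 : (1 + (u + 2 * d)) * (2 * d) <= (1 + (u + 2 * d)) * (4 * v).
  by rewrite ler_wpM2l//; lra.
have ep_eta : (1 + x) * v <= 2 * (1 + x ^+ 3) * v.
  by rewrite ler_wpM2r ?le_double_cube.
have v_ep : v <= (1 + x) * v by rewrite -[leLHS]mul1r ler_wpM2r//; lra.
have ep0 := le_trans v0 v_ep.
apply: (@budget_sum _ _ _ _ v ((1 + x) * v)) => //; last by rewrite mulrA.
- by rewrite mulr_ge0 ?addr_ge0 ?exprn_ge0.
- apply: le_trans A2 _; apply: le_trans A1 _.
  by rewrite le_eqVlt; apply/orP; left; apply/eqP; ring.
- apply: le_trans B3 _; apply: le_trans B1 _.
  by rewrite le_eqVlt; apply/orP; left; apply/eqP; ring.
Qed.

(** When the total error exceeds one the claim is trivial; otherwise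
    all factors are positive and Bernoulli's inequality applies. *)
Lemma combine_lower (n n' T A B d : R) : 0 <= n -> 0 <= T -> 0 <= A -> 0 <= B -> 0 <= d ->
  n * (1 - A) <= n' -> n' * (1 - B) <= (1 + d) * T ->
  n * (1 - (A + B + d)) <= T.
Proof.
move=> n0 T0 A0 B0 d0 nn' n'T.
have [big|small] := leP 1 (A + B + d).
  by apply: le_trans T0; rewrite mulr_ge0_le0//; lra.
have s4 : n * (1 - A) * (1 - B) <= (1 + d) * T.
  by apply: le_trans n'T; rewrite ler_wpM2r//; lra.
have d1 : 0 <= 1 - d by lra.
have s5 := ler_wpM2l d1 s4.
apply: le_trans (_ : (1 - d) * ((1 + d) * T) <= _); last first.
  by have := mulr_ge0 (sqr_ge0 d) T0; lra.
apply: le_trans s5.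
have -> : (1 - d) * (n * (1 - A) * (1 - B)) =
  n * ((1 - (A + B + d)) + (d * (A + B) + A * B * (1 - d))) by ring.
rewrite ler_wpM2l// lerDl addr_ge0// mulr_ge0//.
  exact: addr_ge0.
exact: mulr_ge0.
Qed.

(** The parameter b displaces the threshold to the right.  The loss is polynomial
    in b, hence summable against geometric weights. *)
Lemma bintail_ge_ntail k x b : (0 < k)%N -> 2 <= Num.sqrt k%:R :> R ->
  0 <= x -> 1 + x <= Num.sqrt k%:R -> 0 <= b ->
  ntail x * (1 - 1400 * (b + 3) ^+ 4 * ((1 + x ^+ 3) / Num.sqrt k%:R)) <=
  bintail k (k%:R / 2 + x * (Num.sqrt k%:R / 2) + b).
Proof.
move=> k0 s12 x0 xs b0.
have [h [kh _ lo]] := bintail_even k.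
have [] := mesh_bounds k0 kh; have d0 := @mesh_gt0 R h.
have s2 : Num.sqrt k%:R ^+ 2 = k%:R :> R by rewrite sqr_sqrtr.
move: s12 xs s2; set s := Num.sqrt k%:R => s12 xs s2 q2 q4.
set d := mesh h in d0 q2 q4.
have sv : s * s^-1 = 1 by rewrite divff//; apply/eqP; lra.
have v0 : 0 < s^-1 by rewrite invr_gt0; lra.
set v := s^-1 in sv v0 *.
have dv : d <= 2 * v by nra.
have v1 : v <= 2^-1 by nra.
have hk : k%:R <= (2 * h%:R : R) <= k%:R + 1 by rewrite -natrM natr1 !ler_nat.
pose r : R := k%:R / 2 + x * (s / 2) + b + 2.
have xs0 : 0 <= x * (s / 2) by rewrite mulr_ge0//; lra.
apply: (@le_trans _ _ (bintail (2 * h) r)); last first.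
  apply: le_trans (lo _); apply: bintail_nincr; rewrite /r; lra.
have := @bintail_lower R h r ltac:(rewrite -/d; lra) ltac:(rewrite /r; lra).
have -> : lattice h (r + 1) = lattice h (r - 1) + 2 * d by rewrite /lattice -/d; ring.
have ux : lattice h (r - 1) <= x + 2 * (b + 1) * v.
  rewrite /lattice -/d /r.
  have -> : (k%:R / 2 + x * (s / 2) + b + 2 - 1 - h%:R) * d =
    (k%:R / 2 - h%:R) * d + x * (d * s) / 2 + (b + 1) * d by field.
  have a1 : (k%:R / 2 - h%:R) * d <= 0 by rewrite mulr_le0_ge0 ?(ltW d0)//; lra.
  have a2 : (b + 1) * d <= (b + 1) * (2 * v) by rewrite ler_wpM2l//; lra.
  have a4 : x * (d * s) <= x * 2 by rewrite ler_wpM2l.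
  lra.
have u0 : 0 <= lattice h (r - 1) by rewrite mulr_ge0 ?(ltW d0)// /r; lra.
move: ux u0; set u := lattice h (r - 1) => ux u0; rewrite -/d.
set T := bintail _ _ => low.
have T0 : 0 <= T := bintail_ge0 _ _.
pose a := b + 3; pose dl := 2 * (b + 1) * v.
have dl0 : 0 <= dl by rewrite /dl !mulr_ge0 ?(ltW v0)//; lra.
have := @ntail_shift R (x + dl) dl ltac:(lra) dl0; rewrite addrK.
rewrite -ler_pdivrMr ?expR_gt0// -expRN => sh.
have nu : ntail (x + dl) <= ntail u := ntail_nincr ux.
have eA := expR_ge1Dx (- ((1 + (x + dl)) * dl)).
have eB := expR_ge1Dx (- ((1 + (u + 2 * d)) * (2 * d))).
rewrite -/a; have n0 := ntail_ge0 x.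
have d0' := ltW d0.
have dd : 0 <= 2 * d by rewrite mulr_ge0.
apply: le_trans (_ : ntail x * (1 - ((1 + (x + dl)) * dl +
  ((1 + (u + 2 * d)) * (2 * d) + d ^+ 2 * (1 + u) ^+ 4) + 2 * d)) <= _).
  rewrite ler_wpM2l// lerD2l lerN2; apply: error_budget => //.
  - by rewrite (ltW v0).
  - by rewrite -[leRHS]sv ler_wpM2r// ltW.
  - by rewrite /a lerDr.
  - by rewrite d0'.
  - by have -> : 2 * (a * v) - 4 * v = dl by rewrite /a /dl; ring.
apply: (@combine_lower _ (ntail u)).
- exact: n0.
- exact: T0.
- by rewrite mulr_ge0// !addr_ge0.
- apply: addr_ge0; last by rewrite mulr_ge0 ?sqr_ge0// exprn_ge0// addr_ge0.
  by rewrite mulr_ge0// !addr_ge0.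
- exact: dd.
- by apply: le_trans nu; apply: le_trans sh; rewrite ler_wpM2l.
- apply: le_trans low; rewrite ler_wpM2l ?ntail_ge0// opprD addrA lerD2r.
  exact: eB.
Qed.

End Assembly.

(** * Averaging over the blocks *)

Section Final.
Context {R : realType}.
Implicit Types (r x : R) (k : nat).

(** The range x <= k^(1/6) is used as x^3 <= sqrt k; it makes
    (1 + x)/sqrt k small once sqrt k >= 6^3. *)
Lemma cube_range x (s : R) : 0 <= x -> 6 ^+ 3 <= s -> x ^+ 3 <= s ->
  12 <= s /\ 16 * (1 + x) <= s.
Proof.
move=> x0 s6 x3; split; first by lra.
have [x6|x6] := leP x 6; first by lra.
have : 0 <= (x - 6) * (x + 6) * x by rewrite !mulr_ge0//; lra.
lra.
Qed.

Lemma expR_quarter_le : expR (4^-1) <= 4 / 3 :> R.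
Proof.
have := expR_ge1Dx (- 4^-1 : R); rewrite expRN => h.
have e0 := expR_gt0 (4^-1 : R).
have : (1 - 4^-1) * expR (4^-1) <= 1 :> R by rewrite -ler_pdivlMr// mul1r.
lra.
Qed.

(** The weights decay like 2^(-i) while the exponentials grow like
    expR (i/4) <= (4/3)^i. *)
Lemma sum_weights (w : nat -> nat) k N (b : R) :
  (forall i, (i <= k)%N -> (w i <= 2 ^ (k - i))%N) -> (2 ^ k <= 2 * N)%N ->
  \sum_(i < k.+1) (w i)%:R * expR ((b + i%:R) / 4) <= 6 * N%:R * expR (b / 4).
Proof.
move=> wk kN.
have geo n : \sum_(i < n) (2 / 3) ^+ i <= 3 :> R.
  suff -> : \sum_(i < n) (2 / 3) ^+ i = 3 - 3 * (2 / 3) ^+ n :> R.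
    by rewrite gerBl mulr_ge0// exprn_ge0// divr_ge0.
  elim: n => [|n IH]; first by rewrite big_ord0 expr0; lra.
  by rewrite big_ord_recr/= IH exprS; lra.
apply: (@le_trans _ _ (\sum_(i < k.+1) 2 ^+ k * expR (b / 4) * (2 / 3) ^+ i)).
  apply: ler_sum => i _.
  have ik : (i <= k)%N by rewrite -ltnS.
  have -> : (b + i%:R) / 4 = b / 4 + i%:R * 4^-1 by lra.
  rewrite expRD expRM_natl mulrCA -mulrA [leRHS]mulrCA ler_wpM2l ?expR_ge0//.
  apply: (@le_trans _ _ (2 ^+ (k - i) * (4 / 3) ^+ i)).
    apply: ler_pM;
      [exact: ler0n|by rewrite exprn_ge0// expR_ge0|by rewrite -natrX ler_nat wk|].
    by rewrite lerXn2r ?nnegrE ?expR_ge0 ?expR_quarter_le// divr_ge0.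
  have -> : 2 ^+ k = 2 ^+ (k - i) * 2 ^+ i :> R by rewrite -exprD subnK.
  rewrite -mulrA -exprMn.
  by have -> : 2 * (2 / 3) = 4 / 3 :> R by lra.
rewrite -mulr_sumr.
have p : 0 <= 2 ^+ k * expR (b / 4) :> R by rewrite mulr_ge0 ?expR_ge0// exprn_ge0.
apply: le_trans (ler_wpM2l p (geo k.+1)) _.
have : 2 ^+ k <= 2 * N%:R :> R by rewrite -natrX -natrM ler_nat.
move/(ler_wpM2r (expR_ge0 (b / 4))); lra.
Qed.

(** For a displacement a the error is linear in ep = (1 + x)/sqrt k, at the price
    of a factor expR (a/4) that [sum_weights] can absorb. *)
Lemma expR_le_linear (ep a : R) : 0 <= ep -> 16 * ep <= 1 -> 0 <= a ->
  expR (2 * ep * a) <= 1 + 16 * ep * expR (a / 4).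
Proof.
move=> ep0 ep1 a0.
have h1 := expR_ge1Dx (- (2 * ep * a)); rewrite expRN in h1.
have e0 := expR_gt0 (2 * ep * a).
have h2 : (1 - 2 * ep * a) * expR (2 * ep * a) <= 1.
  by rewrite -ler_pdivlMr// mul1r.
have h3 : expR (2 * ep * a) <= expR (a / 8).
  rewrite ler_expR; have := ler_wpM2r a0 ep1; lra.
have h4 : a <= 8 * expR (a / 8) by have := expR_ge1Dx (a / 8); lra.
have h5 : a * expR (2 * ep * a) <= 8 * expR (a / 8) * expR (a / 8).
  by apply: ler_pM => //; exact: expR_ge0.
have -> : expR (a / 4) = expR (a / 8) * expR (a / 8) by rewrite -expRD; congr expR; lra.
have := ler_wpM2l ep0 h5.
lra.
Qed.

Lemma quartic_le_expR (a : R) : 0 <= a -> a ^+ 4 <= 16 ^+ 4 * expR (a / 4).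
Proof.
move=> a0; have -> : expR (a / 4) = expR (a / 16) ^+ 4.
  by rewrite -expRM_natl; congr expR; lra.
rewrite -exprMn lerXn2r ?nnegrE ?mulr_ge0 ?expR_ge0//.
have := expR_ge1Dx (a / 16); lra.
Qed.

Variable c : nat -> nat.
Hypothesis count_ge_rec : forall m (r : R), (1 <= m)%N ->
  count_ge c (2 * m) r = count_ge c m r + count_ge c m (r - 1).

Local Notation E := (expR (((c 0%N)%:R + 3) / 4) : R).

Lemma count_ge_upper k N x : (0 < k)%N -> 12 <= Num.sqrt k%:R :> R ->
  0 <= x -> 16 * (1 + x) <= Num.sqrt k%:R ->
  (N <= 2 ^ k)%N -> (2 ^ k <= 2 * N)%N ->
  count_ge c N (k%:R / 2 + x * (Num.sqrt k%:R / 2)) <=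
  N%:R * (ntail x * (1 + (20 + 512 * E) * ((1 + x ^+ 3) / Num.sqrt k%:R))).
Proof.
move=> k0 s12 x0 xs Nk kN.
have [w [wN wk /(_ (k%:R / 2 + x * (Num.sqrt k%:R / 2)))/andP[_ +]]] :=
  count_ge_mixture count_ge_rec Nk.
move/le_trans; apply.
have xs1 : x <= Num.sqrt k%:R by lra.
have B (i : nat) : bintail k (k%:R / 2 + x * (Num.sqrt k%:R / 2) - (c 0%N)%:R - i%:R) <=
    (1 + 20 / Num.sqrt k%:R) * ntail x *
    (1 + 16 * ((1 + x) / Num.sqrt k%:R) * expR (((c 0%N)%:R + 3 + i%:R) / 4)).
  have := @bintail_le_ntail R k x ((c 0%N)%:R + i%:R) k0 s12 x0 xs1
    (addr_ge0 (ler0n _ _) (ler0n _ _)).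
  rewrite opprD addrA => /le_trans; apply.
  rewrite ler_wpM2l//.
    by rewrite mulr_ge0 ?ntail_ge0 ?addr_ge0// divr_ge0// sqrtr_ge0.
  have -> : (1 + x) * (2 * ((c 0%N)%:R + i%:R + 3) / Num.sqrt k%:R) =
    2 * ((1 + x) / Num.sqrt k%:R) * ((c 0%N)%:R + 3 + i%:R) by ring.
  apply: expR_le_linear.
  - by rewrite divr_ge0 ?addr_ge0// sqrtr_ge0.
  - by rewrite mulrA ler_pdivrMr ?mul1r//; lra.
  - by rewrite !addr_ge0.
move: s12 xs xs1 B; set s := Num.sqrt k%:R => s12 xs xs1 B.
apply: le_trans (ler_sum _ (fun (i : 'I_k.+1) _ => ler_wpM2l (ler0n _ (w i)) (B i))) _.
have -> : \sum_(i < k.+1) (w i)%:R * ((1 + 20 / s) * ntail x *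
    (1 + 16 * ((1 + x) / s) * expR (((c 0%N)%:R + 3 + i%:R) / 4))) =
  (1 + 20 / s) * ntail x * (N%:R + 16 * ((1 + x) / s) *
    \sum_(i < k.+1) (w i)%:R * expR (((c 0%N)%:R + 3 + i%:R) / 4)).
  have -> : N%:R = \sum_(i < k.+1) (w i)%:R :> R by rewrite -natr_sum wN.
  rewrite mulr_sumr -big_split/= mulr_sumr.
  by apply: eq_bigr => i _; ring.
have sv : s * s^-1 = 1 by rewrite divff//; apply/eqP; lra.
have v0 : 0 < s^-1 by rewrite invr_gt0; lra.
move: (s^-1) sv v0 => v sv v0.
have SW := @sum_weights w k N ((c 0%N)%:R + 3) wk kN.
have v12 : v <= 12^-1 by nra.
have ep0 : 0 <= (1 + x) * v by rewrite mulr_ge0 ?addr_ge0// ltW.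
have v_eta : v <= (1 + x ^+ 3) * v.
  by rewrite -[leLHS]mul1r ler_wpM2r ?(ltW v0)// lerDl exprn_ge0.
have ep_eta : (1 + x) * v <= 2 * (1 + x ^+ 3) * v.
  by rewrite ler_wpM2r ?le_double_cube ?(ltW v0).
have E0 : 0 <= E := expR_ge0 _.
move: SW E0; set SS := \sum_(_ < _) _; set e := expR _ => SW E0.
have SW2 : N%:R + 16 * ((1 + x) * v) * SS <= N%:R * (1 + 96 * ((1 + x) * v) * e).
  have p : 0 <= 16 * ((1 + x) * v) by rewrite mulr_ge0.
  have := ler_wpM2l p SW; lra.
have n0 := ntail_ge0 x.
apply: le_trans (ler_wpM2l (_ : 0 <= (1 + 20 * v) * ntail x) SW2) _.
  by apply: mulr_ge0 => //; lra.
have -> : (1 + 20 * v) * ntail x * (N%:R * (1 + 96 * ((1 + x) * v) * e)) =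
  N%:R * (ntail x * ((1 + 20 * v) * (1 + 96 * ((1 + x) * v) * e))) by ring.
rewrite ler_wpM2l// ler_wpM2l//.
move: ep0 v_eta ep_eta; rewrite -mulrA.
move: ((1 + x) * v) ((1 + x ^+ 3) * v) => ep eta ep0 v_eta ep_eta.
have g1 : e * ep <= e * (2 * eta) by rewrite ler_wpM2l.
have g2 : v * (e * ep) <= 12^-1 * (e * ep) by rewrite ler_wpM2r// mulr_ge0.
lra.
Qed.

Lemma count_ge_lower k N x : (0 < k)%N -> 12 <= Num.sqrt k%:R :> R ->
  0 <= x -> 16 * (1 + x) <= Num.sqrt k%:R ->
  (N <= 2 ^ k)%N -> (2 ^ k <= 2 * N)%N ->
  N%:R * (ntail x * (1 - 8400 * 16 ^+ 4 * E * ((1 + x ^+ 3) / Num.sqrt k%:R))) <=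
  count_ge c N (k%:R / 2 + x * (Num.sqrt k%:R / 2)).
Proof.
move=> k0 s12 x0 xs Nk kN.
have [w [wN wk /(_ (k%:R / 2 + x * (Num.sqrt k%:R / 2)))/andP[+ _]]] :=
  count_ge_mixture count_ge_rec Nk.
apply: le_trans.
set eta := (1 + x ^+ 3) / Num.sqrt k%:R.
have eta0 : 0 <= eta by rewrite divr_ge0 ?sqrtr_ge0 ?addr_ge0 ?exprn_ge0.
have B (i : nat) : ntail x * (1 - 1400 * 16 ^+ 4 * eta * expR ((3 + i%:R) / 4)) <=
    bintail k (k%:R / 2 + x * (Num.sqrt k%:R / 2) - (c 0%N)%:R + i%:R).
  have := @bintail_ge_ntail R k x i%:R k0 ltac:(lra) x0 ltac:(lra) (ler0n _ _).
  rewrite -/eta => L; apply: (le_trans (le_trans _ L)).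
    rewrite ler_wpM2l ?ntail_ge0// lerD2l lerN2.
    have := @quartic_le_expR (i%:R + 3) ltac:(by rewrite addr_ge0).
    rewrite [i%:R + 3]addrC => q4.
    have := ler_wpM2l eta0 q4.
    move: (16 ^+ 4) => z; lra.
  by apply: bintail_nincr; rewrite lerD2r gerBl.
apply: le_trans (ler_sum _ (fun (i : 'I_k.+1) _ => ler_wpM2l (ler0n _ (w i)) (B i))).
have -> : \sum_(i < k.+1) (w i)%:R *
    (ntail x * (1 - 1400 * 16 ^+ 4 * eta * expR ((3 + i%:R) / 4))) =
  ntail x * (N%:R - 1400 * 16 ^+ 4 * eta *
    \sum_(i < k.+1) (w i)%:R * expR ((3 + i%:R) / 4)).
  have -> : N%:R = \sum_(i < k.+1) (w i)%:R :> R by rewrite -natr_sum wN.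
  rewrite mulr_sumr -sumrB mulr_sumr.
  apply: eq_bigr => i _; move: (16 ^+ 4) => z; ring.
have SW := @sum_weights w k N 3 wk kN.
have e3 : expR (3 / 4) <= E.
  by rewrite ler_expR ler_wpM2r// lerDr.
move: SW; set SS := \sum_(_ < _) _ => SW.
have : SS <= 6 * N%:R * E.
  by apply: le_trans SW _; rewrite ler_wpM2l ?mulr_ge0.
move: (E) => e SWe.
have z0 : 0 <= 16 ^+ 4 :> R by apply: exprn_ge0; exact: ler0n.
move: (16 ^+ 4) z0 => z z0.
have {}z0 : 0 <= 1400 * z * eta.
  by apply: mulr_ge0; [apply: mulr_ge0; [exact: ler0n|exact: z0]|exact: eta0].
have h := ler_wpM2l z0 SWe.
have -> : N%:R * (ntail x * (1 - 8400 * z * e * eta)) =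
  ntail x * (N%:R - 1400 * z * eta * (6 * N%:R * e)) by ring.
by rewrite ler_wpM2l ?ntail_ge0// lerD2l lerN2.
Qed.

Lemma count_ge_moderate : exists2 C : R, 0 <= C & forall k N x, (0 < k)%N ->
  6 ^+ 3 <= Num.sqrt k%:R :> R -> 0 <= x -> x ^+ 3 <= Num.sqrt k%:R ->
  (N <= 2 ^ k)%N -> (2 ^ k <= 2 * N)%N ->
  `|count_ge c N (k%:R / 2 + x * (Num.sqrt k%:R / 2)) / N%:R / ntail x - 1| <=
  C * ((1 + x ^+ 3) / Num.sqrt k%:R).
Proof.
have e0 : 0 <= E := expR_ge0 _.
pose z : R := 8400 * 16 ^+ 4 * E.
have z0 : 0 <= z.
  apply: mulr_ge0; last exact: e0.
  by apply: mulr_ge0; [exact: ler0n|apply: exprn_ge0; exact: ler0n].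
pose y : R := 20 + 512 * E.
have y0 : 0 <= y by rewrite /y; lra.
exists (y + z) => [|k N x k0 s6 x0 x3 Nk kN]; first exact: addr_ge0.
have [s12 xs] := cube_range x0 s6 x3.
have U := count_ge_upper k0 s12 x0 xs Nk kN.
have L := count_ge_lower k0 s12 x0 xs Nk kN.
rewrite -/y -/z in U L; move: z z0 y y0 U L => z z0 y y0.
have q0 := ntail_gt0 x.
have N0 : 0 < N%:R :> R.
  rewrite ltr0n lt0n; apply: contraTneq kN => ->.
  by rewrite muln0 -ltnNge expn_gt0.
have : 0 <= (1 + x ^+ 3) / Num.sqrt k%:R by rewrite divr_ge0 ?addr_ge0 ?exprn_ge0 ?sqrtr_ge0.
move: ((1 + x ^+ 3) / _) (count_ge _ _ _) => eta P eta0 U L.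
have {}U : P / N%:R / ntail x <= 1 + y * eta.
  by rewrite ler_pdivrMr// [leRHS]mulrC ler_pdivrMr// [leRHS]mulrC.
have {}L : 1 - z * eta <= P / N%:R / ntail x.
  by rewrite ler_pdivlMr// [leLHS]mulrC ler_pdivlMr// [leLHS]mulrC.
have := mulr_ge0 z0 eta0; have := mulr_ge0 y0 eta0.
clear -U L; rewrite mulrDl ler_norml => a b; apply/andP; split; lra.
Qed.

End Final.

Theorem proposition4p2 (R : realType) (code : nat -> seq bool)
    (code_rec : forall m : nat, (1 <= m)%N ->
      ones_law R code (2 * m - 1) =
      add_bernoulli_half (ones_law R code (m - 1))) :
  exists C : R, forall (n k : nat) (x : R),
    (1 <= n)%N ->
    (2 ^ (k - 1) - 1 < n <= 2 ^ k - 1)%N ->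
    0 <= x <= k%:R `^ (1 / 6) ->
    exists2 theta : R, `|theta| <= C &
      fine (uniform_upto n [set y | x <= standardized_ones code k y]) /
        (1 - Phi x) =
      1 + theta * (1 + x ^+ 3) * (1 / Num.sqrt k%:R).
Proof.
have [C1 C10 H1] := count_ge_moderate (ones_count_ge_double code_rec).
pose C2 : R := 6 ^+ 3 / ntail 6.
have q6 := @ntail_gt0 R 6.
have C20 : 0 <= C2 by rewrite divr_ge0 ?exprn_ge0 ?(ltW q6).
exists (C1 + C2) => n k x n1 nk /andP[x0 xk].
have k0 : (0 < k)%N by case: k nk {xk} => // /andP[] ? ?; lia.
have nk1 : (2 ^ (k - 1) <= n)%N.
  by case/andP: nk => + _; have := expn_gt0 2 (k - 1); lia.
have nk2 : (n.+1 <= 2 ^ k)%N.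
  by case/andP: nk => _ +; have := expn_gt0 2 k; lia.
have kN : (2 ^ k <= 2 * n.+1)%N.
  by rewrite -(subnK k0) addn1 expnS leq_mul2l (leq_trans nk1).
set s := Num.sqrt k%:R.
have s0 : 0 < s by rewrite sqrtr_gt0 ltr0n.
have s2 : s ^+ 2 = k%:R by rewrite sqr_sqrtr.
have x3 : x ^+ 3 <= s.
  rewrite -(@ler_pXn2r R 2) ?nnegrE ?exprn_ge0 ?(ltW s0)// -exprM.
  have -> : s ^+ 2 = (k%:R `^ (1 / 6)) ^+ 6.
    by rewrite s2 -powR_mulrn ?powR_ge0// -powRrM divfK// powRr1.
  by rewrite lerXn2r ?nnegrE// powR_ge0.
pose r := k%:R / 2 + x * (s / 2).
have Es : Num.sqrt (k%:R / 4) = s / 2.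
  rewrite sqrtrM//; congr (_ * _).
  have -> : 4^-1 = 2^-1 ^+ 2 :> R by field.
  by rewrite sqrtr_sqr ger0_norm.
have -> : fine (uniform_upto n [set y | x <= standardized_ones code k y]) =
    count_ge (ones code) n.+1 r / n.+1%:R.
  rewrite -[RHS]/(fine _%:E) -uniform_upto_count_ge; congr (fine (_ _)).
  apply/seteqP; split => y /=; rewrite /standardized_ones.
  - by rewrite Es => h; rewrite -lerBrDl -ler_pdivlMr ?divr_gt0.
  - by rewrite Es => h; rewrite ler_pdivlMr ?divr_gt0// lerBrDl.
have := H1 k n.+1 x k0 _ x0 x3 nk2 kN; rewrite -/s -/r.
set P := _ / n.+1%:R; rewrite -/(ntail x) => {}H1.
have q0 := ntail_gt0 x.
have x30 : 0 <= x ^+ 3 by rewrite exprn_ge0.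
pose eta := (1 + x ^+ 3) / s.
have eta0 : 0 < eta by rewrite divr_gt0// ltr_pwDl.
suff bound : `|P / ntail x - 1| <= (C1 + C2) * eta.
  exists ((P / ntail x - 1) / eta).
    by rewrite normrM normfV (gtr0_norm eta0) ler_pdivrMr.
  by rewrite mul1r -mulrA -/eta divfK ?gt_eqF// addrC subrK.
have [s6|s6] := leP (6 ^+ 3) s.
  by apply: le_trans (H1 s6) _; rewrite ler_wpM2r ?(ltW eta0)// lerDl.
(* Only finitely many k remain; there x <= 6, and the quotient is bounded. *)
have x6 : x <= 6.
  rewrite leNgt; apply/negP => h.
  suff : 6 ^+ 3 <= s by rewrite leNgt s6.
  by apply: le_trans x3; rewrite lerXn2r ?nnegrE// ltW.
have sV : 1 <= 6 ^+ 3 * eta.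
  by rewrite /eta mulrA ler_pdivlMr// mul1r (le_trans (ltW s6))// ler_peMr ?exprn_ge0// lerDl.
have P0 : 0 <= P by rewrite divr_ge0// sumr_ge0.
have P1 : P <= 1.
  rewrite ler_pdivrMr// mul1r /count_ge.
  apply: (@le_trans _ _ (\sum_(y < n.+1) 1)); last by rewrite sumr_const card_ord.
  by apply: ler_sum => i _; case: (r <= _).
have PQ : P / ntail x <= (ntail 6)^-1.
  apply: le_trans (_ : 1 / ntail x <= _); first by rewrite ler_wpM2r// invr_ge0 ltW.
  by rewrite mul1r lef_pV2// ntail_nincr.
have Q1 : 1 <= (ntail (6 : R))^-1.
  by rewrite -[leLHS]invr1 lef_pV2 ?posrE ?ltr01// ntail_le1.
have PQ0 : 0 <= P / ntail x by rewrite divr_ge0// ltW.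
have fin : (ntail 6)^-1 <= C2 * eta.
  by rewrite /C2 mulrAC -[leLHS]mul1r ler_wpM2r// invr_ge0 ltW.
have := mulr_ge0 C10 (ltW eta0); rewrite [(C1 + C2) * eta]mulrDl.
move: (C1 * eta) (C2 * eta) (P / ntail x) (ntail 6)^-1 PQ Q1 PQ0 fin; clear => p1 p2 p3 p4.
by move=> PQ Q1 PQ0 fin p10; rewrite ler_norml; apply/andP; split; lra.
Qed.
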